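(* Let $q>0$ and let $X_1,\ldots,X_n$ be i.i.d. random vectors in $\mathbb{R}^d$ with law $\mu(dx)=\psi(x)dx$, where $\psi$ is even with positive integrable Fourier transform. Let $p\in(0,2]$ and let $(\mathbb{R}^d,\|\cdot\|)$ be a quasi-normed space that embeds isometrically into $L_p$. (A) Suppose that for each $t\in\mathbb{R}^d$ the function $[0,+\infty)\ni s\mapsto\hat\psi(s^{1/q}t)$ is log-convex. Then for each $\lambda>0$ the function $$(0,+\infty)^n\ni a\mapsto\mathbb{E}\,e^{-\lambda\left\|a_1^{1/q}X_1+\cdots+a_n^{1/q}X_n\right\|^p}$$ is log-convex. Moreover, if $\mathbb{E}\|X_1\|^p<+\infty$, then the function $$[0,+\infty)^n\ni(a_1,\ldots,a_n)\mapsto\mathbb{E}\left\|a_1^{1/q}X_1+\cdots+a_n^{1/q}X_n\right\|^p$$ is Schur concave. (B) If instead for each $t\in\mathbb{R}^d$ the function $[0,+\infty)\ni s\mapsto\hat\psi(s^{1/q}t)$ is log-concave, then the first function is Schur concave for each $\lambda>0$ and, if $\mathbb{E}\|X_1\|^p<+\infty$, the second function is Schur convex.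
   Context: Fourier transform convention: $\hat f(x)=\int_{\mathbb{R}^d}f(y)e^{-2\pi i\langle x,y\rangle}dy$; ''positive'' means $\ge0$. Quasi-norms $\|\cdot\|$ on $\mathbb{R}^d$ are Minkowski functionals $\|x\|=\inf\{\lambda>0:x\in\lambda K\}$ of symmetric star bodies $K$ ($K=-K$ compact, $tK\subset K$ for $t\in[0,1]$, $\|\cdot\|$ continuous). $(\mathbb{R}^d,\|\cdot\|)$ embeds isometrically in $L_p$ if there is a linear map $S:\mathbb{R}^d\to L_p([0,1])$ with $\|Sx\|_{L_p}=\|x\|$ for all $x$. A function $f:C\to[0,\infty)$ on a convex set $C$ is log-convex (resp. log-concave) if $f(\lambda x+(1-\lambda)y)\le f(x)^\lambda f(y)^{1-\lambda}$ (resp. $\ge$) for all $x,y\in C$, $\lambda\in(0,1)$. For $x,y\in\mathbb{R}^n$, write $x\prec y$ if, after rearranging the coordinates of each in decreasing order, $x_1+\cdots+x_i\le y_1+\cdots+y_i$ for $i=1,\ldots,n-1$ and $x_1+\cdots+x_n=y_1+\cdots+y_n$. $f$ is Schur convex (resp. Schur concave) if $x\prec y$ implies $f(x)\le f(y)$ (resp. $f(x)\ge f(y)$) for all $x,y$ in its domain. *)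

(* Defs.v *)
From HB Require Import structures.
From mathcomp Require Import all_boot all_order all_algebra.
From mathcomp Require Import all_classical all_reals all_analysis.
From mathcomp Require Import complex.

Set Implicit Arguments.
Unset Strict Implicit.
Unset Printing Implicit Defensive.

Import Order.TTheory GRing.Theory Num.Theory.
Import numFieldNormedType.Exports.

Local Open Scope classical_set_scope.
Local Open Scope ring_scope.

(* The Borel sigma-algebra of R^d, generated by the coordinate maps, as the
   library does for [n.-tuple]. *)
Section measurable_rV.
Context {R : realType} {d : nat}.

Definition rV_coord (i : 'I_d) (x : 'rV[R]_d) : measurableTypeR R := x ord0 i.

Let rV_set0 : g_sigma_preimage rV_coord set0.
Proof. exact: sigma_algebra0. Qed.

Let rV_setC A : g_sigma_preimage rV_coord A -> g_sigma_preimage rV_coord (~` A).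
Proof. exact: sigma_algebraC. Qed.

Let rV_bigcup (F : (set 'rV[R]_d)^nat) :
  (forall i, g_sigma_preimage rV_coord (F i)) ->
  g_sigma_preimage rV_coord (\bigcup_i (F i)).
Proof. exact: sigma_algebra_bigcup. Qed.

HB.instance Definition _ := @isMeasurable.Build default_measure_display
  'rV[R]_d (g_sigma_preimage rV_coord) rV_set0 rV_setC rV_bigcup.

Lemma measurable_rV_coord (i : 'I_d) :
  measurable_fun [set: 'rV[R]_d] (rV_coord i).
Proof.
move=> _ Y mY; rewrite setTI; apply: sub_sigma_algebra => /=.
rewrite -bigcup_seq/=; exists i => /=; first by rewrite mem_index_enum.
by exists Y => //; rewrite setTI.
Qed.

Lemma measurable_fun_rVP d' (T : measurableType d') (f : T -> 'rV[R]_d) :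
  (forall i, measurable_fun [set: T] (rV_coord i \o f)) ->
  measurable_fun [set: T] f.
Proof.
move=> mf _ Y mY; rewrite setTI.
suff: @measurable _ 'rV[R]_d `<=` [set B | measurable (f @^-1` B)] by exact.
apply: smallest_sub => [|A].
  split => /=.
  - by rewrite preimage_set0.
  - by move=> A mA; rewrite setTD preimage_setC; exact: measurableC.
  - by move=> F mF; rewrite preimage_bigcup; exact: bigcup_measurable.
rewrite -bigcup_seq/= => -[i _ [B mB <-]].
by rewrite setTI -comp_preimage -[X in measurable X]setTI; exact: mf.
Qed.

End measurable_rV.

(* Lebesgue measure on R^d, obtained from that of R by iterated products. *)
Section lebesgue_rV.
Context {R : realType}.

Definition rV_cons d (z : 'rV[R]_d * measurableTypeR R) : 'rV[R]_d.+1 :=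
  row_mx (z.2%:M : 'rV[R]_1) z.1.

Lemma measurable_rV_cons d : measurable_fun setT (@rV_cons d).
Proof.
apply: measurable_fun_rVP => i.
have [j ->|j ->] := split_ordP (i : 'I_(1 + d)).
- rewrite (_ : _ \o _ = snd); first exact: measurable_snd.
  apply/funext => z /=.
  have : (row_mx z.2%:M z.1 : 'rV[R]_(1 + d)) ord0 (lshift d j) = z.2.
    by rewrite row_mxEl !ord1 mxE eqxx mulr1n.
  exact.
- rewrite (_ : _ \o _ = rV_coord j \o fst).
    by apply: measurableT_comp => //; exact: measurable_rV_coord.
  apply/funext => z /=; exact: (@row_mxEr _ 1 1 d).
Qed.

(* The generated instance name is spelled out because the canonical measure on
   [pushforward m f] carries the measurability proof of [f]. *)
Fixpoint lebesgue_rV (d : nat) : {measure set 'rV[R]_d -> \bar R} :=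
  match d with
  | 0%N => \d_(0 : 'rV[R]_0)
  | d'.+1 => measure_function_pushforward__canonical__measure_function_Measure
      (lebesgue_rV d' \x lebesgue_measure)%E (@measurable_rV_cons d')
  end.

End lebesgue_rV.

Section fourier.
Context {R : realType} {d : nat}.

Definition dotv (x y : 'rV[R]_d) : R := \sum_i x ord0 i * y ord0 i.

(* \int f(y) e^{-2 i pi <x, y>} dy for a real-valued f; the library has no
   integral of complex-valued functions, so the real and imaginary parts are
   integrated separately. *)
Definition fourier (f : 'rV[R]_d -> R) (x : 'rV[R]_d) : R[i] :=
  Complex (\int[lebesgue_rV d]_y (f y * cos (- (2 * pi * dotv x y))))
          (\int[lebesgue_rV d]_y (f y * sin (- (2 * pi * dotv x y)))).

Definition complex_integrable (g : 'rV[R]_d -> R[i]) :=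
  (lebesgue_rV d).-integrable setT (fun x => (complex.Re (g x))%:E) /\
  (lebesgue_rV d).-integrable setT (fun x => (complex.Im (g x))%:E).

End fourier.

Section quasi_norm.
Context {R : realType} {d : nat}.

(* The value is +oo when no dilate of K contains x. *)
Definition minkowski (K : set 'rV[R]_d) (x : 'rV[R]_d) : \bar R :=
  ereal_inf [set l%:E | l in [set l : R | 0 < l /\ ( *:%R l @` K) x]].

Definition quasi_norm (N : 'rV[R]_d -> R) :=
  exists K : set 'rV[R]_d,
    [/\ compact K,
        -%R @` K = K,
        forall t : R, 0 <= t <= 1 -> *:%R t @` K `<=` K,
        forall x, (N x)%:E = minkowski K x &
        continuous N].

Definition lebesgue01 : {measure set (measurableTypeR R) -> \bar R} :=
  mrestr lebesgue_measure (measurable_itv `[0 : R, 1]).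

(* Elements of L_p([0,1]) are represented by measurable functions, so that
   linearity is required up to almost everywhere equality on [0,1]. *)
Definition embeds_in_Lp (p : R) (N : 'rV[R]_d -> R) :=
  exists S : 'rV[R]_d -> measurableTypeR R -> R,
    [/\ forall x, measurable_fun setT (S x),
        forall (a : R) x y,
          {ae lebesgue01, forall u, S (a *: x + y) u = a * S x u + S y u} &
        forall x, Lnorm lebesgue01 p%:E (EFin \o S x) = (N x)%:E].

End quasi_norm.

Section random_vectors.
Context d' (T : measurableType d') {R : realType} (P : probability T R).
Context {d : nat}.

Definition has_density (X : {RV P >-> 'rV[R]_d}) (f : 'rV[R]_d -> R) :=
  [/\ measurable_fun setT f,
      forall x, 0 <= f x &
      forall A, measurable A ->
        distribution P X A = (\int[lebesgue_rV d]_(x in A) (f x)%:E)%E].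

Definition independent_RVs (I : finType) (X : I -> {RV P >-> 'rV[R]_d}) :=
  forall (J : {set I}) (A : I -> set 'rV[R]_d),
    (forall i, measurable (A i)) ->
    P (\bigcap_(i in [set` J]) X i @^-1` A i) =
    (\prod_(i in J) P (X i @^-1` A i))%E.

End random_vectors.

Definition log_convex {R : realType} {E : lmodType R} (C : set E) (f : E -> R) :=
  (forall x, C x -> 0 <= f x) /\
  forall (x y : E) (l : R), C x -> C y -> 0 < l < 1 ->
    f (l *: x + (1 - l) *: y) <= f x `^ l * f y `^ (1 - l).

Definition log_concave {R : realType} {E : lmodType R} (C : set E) (f : E -> R) :=
  (forall x, C x -> 0 <= f x) /\
  forall (x y : E) (l : R), C x -> C y -> 0 < l < 1 ->
    f x `^ l * f y `^ (1 - l) <= f (l *: x + (1 - l) *: y).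

Section schur.
Context {R : realType} {n : nat}.

Definition decreasing_rearrangement (x : 'rV[R]_n) : seq R :=
  sort >=%R [seq x ord0 i | i <- enum 'I_n].

Definition majorized (x y : 'rV[R]_n) :=
  (forall k, (0 < k < n)%N ->
    \sum_(j < k) (decreasing_rearrangement x)`_j <=
    \sum_(j < k) (decreasing_rearrangement y)`_j) /\
  \sum_i x ord0 i = \sum_i y ord0 i.

Definition schur_convex disp (Y : porderType disp) (C : set 'rV[R]_n)
    (f : 'rV[R]_n -> Y) :=
  forall x y, C x -> C y -> majorized x y -> (f x <= f y)%O.

Definition schur_concave disp (Y : porderType disp) (C : set 'rV[R]_n)
    (f : 'rV[R]_n -> Y) :=
  forall x y, C x -> C y -> majorized x y -> (f y <= f x)%O.

Definition positive_orthant : set 'rV[R]_n := [set a | forall i, 0 < a ord0 i].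

Definition nonneg_orthant : set 'rV[R]_n := [set a | forall i, 0 <= a ord0 i].

End schur.

Section functionals.
Context d' (T : measurableType d') {R : realType} (P : probability T R).
Context {d n : nat}.
Variables (X : 'I_n -> {RV P >-> 'rV[R]_d}) (N : 'rV[R]_d -> R) (p q : R).

Definition weighted_sum (a : 'rV[R]_n) (w : T) : 'rV[R]_d :=
  \sum_i a ord0 i `^ q^-1 *: X i w.

(* The integrand lies in [0, 1], so [fine] only changes the type. *)
Definition laplace_functional (l : R) (a : 'rV[R]_n) : R :=
  fine 'E_P[fun w => expR (- l * N (weighted_sum a w) `^ p)%R]%E.

Definition moment_functional (a : 'rV[R]_n) : \bar R :=
  'E_P[fun w => (N (weighted_sum a w) `^ p)%R]%E.

End functionals.

(* Main.v *)
Require Import Defs.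
From HB Require Import structures.
From mathcomp Require Import all_boot all_order all_algebra.
From mathcomp Require Import all_classical all_reals all_analysis.
From mathcomp Require Import complex measurable_realfun ring lra.
Set Implicit Arguments.
Unset Strict Implicit.
Unset Printing Implicit Defensive.
Import Order.TTheory GRing.Theory Num.Theory.
Import numFieldNormedType.Exports.
Local Open Scope classical_set_scope.
Local Open Scope ring_scope.

(** The function [exp (- l * N x ^ p)] is positive definite, because [N x ^
    p] is an integral over [0, 1] of [| <x, sg u> | ^ p] and [| . | ^ p] is
    negative definite for [0 < p <= 2]. Were it written as a mixture of the
    characters [cos <t, x>], the Laplace functional at [a] would be the same
    mixture of [E cos <t, sum_i a_i^(1/q) X_i>], which by independence is
    [prod_i Re (fourier psi (a_i^(1/q) t / (2 pi)))]. The imaginary part of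
    the Fourier transform vanishes because the transform is nonnegative.
    Every claim thereby reduces to an inequality between such products at a
    fixed [t].

    Each claim on the Laplace functional is a family of linear inequalities
    [0 <= sum_j c_j F(a_j)]: log-convexity of a positive [F] amounts to [F(l
    x + (1-l) y) <= l s^(1-l) F(x) + (1-l) s^(-l) F(y)] for all [s > 0], by
    the weighted arithmetic-geometric mean inequality ([weighted_AMGM],
    [geometric_mean_tangent]). So fix points [a_j] and weights [c_j], let [L
    g = sum_j c_j E g(W_j)] with [W_j] the weighted sum at [a_j], and
    suppose that [L] is nonnegative on all characters. No mixing measure,
    hence neither Bochner's theorem nor stable laws, is needed to deduce [0
    <= L (exp (- l N^p))] ([laplace_functional_lin_ge0]). Call [g] positive
    definite for [L] when [L (g cos <t, .>)] is nonnegative for every [t],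
    and [h] a multiplier when multiplication by [h] preserves this.
    Multipliers contain the characters and are closed under nonnegative
    combinations, products, bounded limits, exponentials, and integral
    mixtures ([multiplier_lim], [multiplier_expR], [multiplier_mix]).

    To reach [exp (- l N^p)], write [p = 2 a] with [0 < a <= 1]. The
    binomial series [1 - (1 - z)^a] has nonnegative coefficients
    ([binom_coef_le0], [binom_psum_cvg]), so [1 - (1 - z)^a] is a multiplier
    for [z = rho (1 + cos (s / m)) / 2], where [s = <x, sg u>] and [rho <
    1]. For [rho] close to 1 and large [m], [(4 m^2 (1 - z))^a] tends to
    [|s|^p]. Integrating over [u], exponentiating and letting [m] tend to
    infinity gives the result ([multiplier_exp_dotv]).

    For Schur convexity, the products are compared by a multiplicative
    Karamata inequality, proved by transfers between two coordinates so that
    vanishing factors cause no trouble ([prod_majorized]). Lastly, [E (1 -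
    exp (- l Y)) / l] is at most [E Y] and tends to it as [l] tends to 0, so
    inequalities between Laplace transforms reverse into inequalities
    between means, by Fatou's lemma ([le_mean_laplace]). Infinite means are
    allowed. *)

(** * Bounded measurable functions and their integrals *)

(** Bounded real-valued measurable functions, as a predicate on functions. *)
Definition bounded_mfun {R : realType} {d'} {T : measurableType d'}
    (f : T -> R) :=
  measurable_fun setT f /\ exists M, forall x, `|f x| <= M.

Section bounded_mfun_theory.
Context {R : realType} {d'} {T : measurableType d'}.
Implicit Types f g : T -> R.

Lemma bounded_mfun_cst (c : R) : bounded_mfun (fun _ : T => c).
Proof. by split; [exact: measurable_cst | exists `|c|]. Qed.

Lemma bounded_mfunD f g : bounded_mfun f -> bounded_mfun g ->
  bounded_mfun (fun x => f x + g x).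
Proof.
move=> [mf [M fM]] [mg [M' gM']]; split; first exact: measurable_funD.
by exists (M + M') => x; rewrite (le_trans (ler_normD _ _))// lerD.
Qed.

Lemma bounded_mfunM f g : bounded_mfun f -> bounded_mfun g ->
  bounded_mfun (fun x => f x * g x).
Proof.
move=> [mf [M fM]] [mg [M' gM']]; split; first exact: measurable_funM.
by exists (M * M') => x; rewrite normrM ler_pM.
Qed.

Lemma bounded_mfunN f : bounded_mfun f -> bounded_mfun (fun x => - f x).
Proof.
move=> [mf [M fM]]; split; first exact: measurableT_comp.
by exists M => x; rewrite normrN.
Qed.

Lemma bounded_mfunB f g : bounded_mfun f -> bounded_mfun g ->
  bounded_mfun (fun x => f x - g x).
Proof. by move=> bf bg; apply: bounded_mfunD => //; exact: bounded_mfunN. Qed.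

Lemma bounded_mfun_prod (I : Type) (r : seq I) (P : pred I) (F : I -> T -> R) :
  (forall i, bounded_mfun (F i)) ->
  bounded_mfun (fun x => \prod_(i <- r | P i) F i x).
Proof.
move=> bF; elim: r => [|i r IH].
  by under eq_fun do rewrite big_nil; exact: bounded_mfun_cst.
under eq_fun do rewrite big_cons.
by case: (P i) => //; exact: bounded_mfunM.
Qed.

Lemma bounded_mfun_cos f :
  measurable_fun setT f -> bounded_mfun (fun x => cos (f x)).
Proof.
move=> mf; split.
  by apply: measurableT_comp => //; apply: continuous_measurable_fun;
     exact: continuous_cos.
by exists 1 => x; rewrite ler_norml cos_geN1 cos_le1.
Qed.

Lemma bounded_mfun_sin f :
  measurable_fun setT f -> bounded_mfun (fun x => sin (f x)).
Proof.
move=> mf; split.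
  by apply: measurableT_comp => //; apply: continuous_measurable_fun;
     exact: continuous_sin.
by exists 1 => x; rewrite ler_norml sin_geN1 sin_le1.
Qed.

Lemma bounded_mfun_indic (A : set T) :
  measurable A -> bounded_mfun (\1_A : T -> R).
Proof.
move=> mA; split; first exact: measurable_indic.
by exists 1 => x; rewrite indicE; case: (x \in A); rewrite ?normr1 ?normr0.
Qed.

Lemma bounded_mfun_comp {d2} {T2 : measurableType d2} (Y : T2 -> T) f :
  measurable_fun setT Y -> bounded_mfun f -> bounded_mfun (fun x => f (Y x)).
Proof.
move=> mY [mf [M fM]]; split; first exact: (measurableT_comp mf mY).
by exists M.
Qed.

Lemma bounded_mfun_lim (f_ : nat -> T -> R) f (M : R) :
  (forall n, measurable_fun setT (f_ n)) -> (forall n x, `|f_ n x| <= M) ->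
  (forall x, f_ ^~ x @ \oo --> f x) -> bounded_mfun f.
Proof.
move=> mf fM cf; split.
  by apply: (measurable_fun_cvg mf) => x _; exact: cf.
exists M => x; apply: (cvgr_to_le (cvg_norm (cf x))).
by near=> n => /=; exact: fM.
Unshelve. all: by end_near. Qed.

End bounded_mfun_theory.

Section integral_bounded_mfun.
Context {R : realType} {d'} {T : measurableType d'}
  (mu : {finite_measure set T -> \bar R}).
Implicit Types f g : T -> R.

Lemma bounded_mfun_integrable f :
  bounded_mfun f -> mu.-integrable setT (EFin \o f).
Proof.
move=> [mf [M fM]]; apply: measurable_bounded_integrable => //.
  by have := fin_num_measure mu setT measurableT;
     rewrite fin_numE ltey => /andP[].
exists M; split; first exact: num_real.
by move=> x Mx y _; exact: le_trans (fM y) (ltW Mx).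
Qed.

End integral_bounded_mfun.

Section Rintegral_extra.
Context {R : realType} {d'} {T : measurableType d'}
  (mu : {measure set T -> \bar R}).

Lemma integrableM_bounded (w f : T -> R) :
  mu.-integrable setT (EFin \o w) -> bounded_mfun f ->
  mu.-integrable setT (EFin \o (fun x => w x * f x)).
Proof.
move=> iw [mf [M fM]].
have mw : measurable_fun setT w by exact/measurable_EFinP/(measurable_int mu).
apply: (@le_integrable _ _ _ mu _ measurableT _ (fun x => (`|M| * `|w x|)%:E)).
- by apply/measurable_EFinP; exact: measurable_funM.
- move=> x _ /=; rewrite lee_fin normrM mulrC normrM !normr_id ler_wpM2r//.
  exact: le_trans (fM x) (ler_norm M).
- have := integrableZl measurableT `|M| (integrable_norm iw).
  exact.
Qed.

Lemma Rintegral_sum (I : Type) (r : seq I) (P : pred I) (F : I -> T -> R) :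
  (forall i, mu.-integrable setT (EFin \o F i)) ->
  \int[mu]_x (\sum_(i <- r | P i) F i x) =
  \sum_(i <- r | P i) \int[mu]_x F i x.
Proof.
move=> iF; rewrite /Rintegral.
under eq_integral do rewrite -sumEFin.
rewrite (integral_sum measurableT iF).
rewrite sum_fine// => i _; exact: (integrable_fin_num measurableT (iF i)).
Qed.

Lemma Rintegral_dominated (f_ : nat -> T -> R) (f g : T -> R) :
  (forall n, measurable_fun setT (f_ n)) ->
  (forall x, f_ ^~ x @ \oo --> f x) ->
  mu.-integrable setT (EFin \o g) -> (forall n x, `|f_ n x| <= g x) ->
  (fun n => \int[mu]_x f_ n x) @ \oo --> \int[mu]_x f x.
Proof.
move=> mf cf ig fg.
have [] := @dominated_convergence _ _ _ mu _ measurableT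
  (fun n x => (f_ n x)%:E) (fun x => (f x)%:E) (fun x => (g x)%:E).
- by move=> n; exact/measurable_EFinP.
- by apply/measurable_EFinP; apply: (measurable_fun_cvg mf) => x _; exact: cf.
- apply: aeW => x _; apply: cvg_EFin; first by near=> n.
  exact: cf.
- exact: ig.
- by apply: aeW => x n _ /=; rewrite lee_fin.
move=> iwf _ c; apply: fine_cvg; rewrite fineK//.
exact: (integrable_fin_num measurableT iwf).
Unshelve. all: by end_near. Qed.

Lemma Rintegral_weighted_cvg (w : T -> R) (f_ : nat -> T -> R) (f : T -> R)
    (M : R) :
  mu.-integrable setT (EFin \o w) ->
  (forall n, measurable_fun setT (f_ n)) -> (forall n x, `|f_ n x| <= M) ->
  (forall x, f_ ^~ x @ \oo --> f x) ->
  (fun n => \int[mu]_x (w x * f_ n x)) @ \oo --> \int[mu]_x (w x * f x).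
Proof.
move=> iw mf fM cf.
have mw : measurable_fun setT w by exact/measurable_EFinP/(measurable_int mu).
apply: (@Rintegral_dominated _ _ (fun x => `|M| * `|w x|)).
- by move=> n; exact: measurable_funM.
- by move=> x; apply: cvgM; [exact: cvg_cst|exact: cf].
- have := integrableZl measurableT `|M| (integrable_norm iw).
  exact.
- move=> n x; rewrite normrM mulrC ler_wpM2r//.
  exact: le_trans (fM n x) (ler_norm M).
Qed.

End Rintegral_extra.

Section same_weighted_law.
Context {R : realType} {d0 d1 d2} {E : measurableType d0}
  {T1 : measurableType d1} {T2 : measurableType d2}
  (m1 : {measure set T1 -> \bar R}) (m2 : {measure set T2 -> \bar R})
  (w1 : T1 -> R) (w2 : T2 -> R) (Y1 : T1 -> E) (Y2 : T2 -> E).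
Hypotheses (iw1 : m1.-integrable setT (EFin \o w1))
  (iw2 : m2.-integrable setT (EFin \o w2))
  (mY1 : measurable_fun setT Y1) (mY2 : measurable_fun setT Y2).
Hypothesis same_law : forall A, measurable A ->
  \int[m1]_x (w1 x * \1_A (Y1 x)) = \int[m2]_x (w2 x * \1_A (Y2 x)).

Import HBNNSimple.

(* A simple function is a finite combination of indicators. *)
Let same_sfun (g : {nnsfun E >-> R}) :
  \int[m1]_x (w1 x * g (Y1 x)) = \int[m2]_x (w2 x * g (Y2 x)).
Proof.
pose s : seq R := finmap.enum_fset (fset_set (g @` setT)).
have H d3 (T3 : measurableType d3) (m3 : {measure set T3 -> \bar R})
    (w3 : T3 -> R) (Y3 : T3 -> E) : m3.-integrable setT (EFin \o w3) ->
    measurable_fun setT Y3 -> \int[m3]_x (w3 x * g (Y3 x)) =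
    \sum_(i < size s) s`_i *
      \int[m3]_x (w3 x * \1_(g @^-1` [set s`_i]) (Y3 x)).
  move=> iw3 mY3.
  have ii (i : 'I_(size s)) : m3.-integrable setT
      (EFin \o (fun x => w3 x * \1_(g @^-1` [set s`_i]) (Y3 x))).
    apply: integrableM_bounded => //; apply: (bounded_mfun_comp mY3).
    exact: bounded_mfun_indic.
  under eq_Rintegral => x _ do rewrite fimfunEord mulr_sumr.
  rewrite Rintegral_sum; last first.
    move=> i; have := integrableZl measurableT s`_i (ii i).
    by apply: eq_integrable => // x _ /=; rewrite -EFinM mulrCA.
  apply: eq_bigr => i _; rewrite -RintegralZl//.
  by apply: eq_Rintegral => x _; rewrite mulrCA.
rewrite (H _ _ _ _ _ iw1 mY1) (H _ _ _ _ _ iw2 mY2).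
by apply: eq_bigr => i _; rewrite same_law.
Qed.

Let same_ge0 (f : E -> R) : (forall x, 0 <= f x) -> bounded_mfun f ->
  \int[m1]_x (w1 x * f (Y1 x)) = \int[m2]_x (w2 x * f (Y2 x)).
Proof.
move=> f0 [mf [M fM]].
have mEf : measurable_fun setT (EFin \o f) by exact/measurable_EFinP.
pose g n := nnsfun_approx measurableT mEf n.
have cg x : (g n x) @[n --> \oo] --> f x.
  have := @cvg_nnsfun_approx _ _ _ _ measurableT _ mEf _ x I.
  by move=> /(_ (fun x _ => f0 x)) /fine_cvg.
have gM n x : `|g n x| <= M.
  rewrite ger0_norm; last exact: fun_ge0.
  apply: le_trans (fM x); rewrite ger0_norm// /g nnsfun_approxE -lee_fin.
  exact: (@le_approx _ _ _ setT (EFin \o f) n x (fun x _ => f0 x) I).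
have c1 : (fun n => \int[m1]_x (w1 x * g n (Y1 x))) @ \oo -->
    \int[m1]_x (w1 x * f (Y1 x)).
  apply: (@Rintegral_weighted_cvg _ _ _ _ _ (fun n x => g n (Y1 x)) _ M) => //.
  by move=> n; apply: measurableT_comp.
have c2 : (fun n => \int[m2]_x (w2 x * g n (Y2 x))) @ \oo -->
    \int[m2]_x (w2 x * f (Y2 x)).
  apply: (@Rintegral_weighted_cvg _ _ _ _ _ (fun n x => g n (Y2 x)) _ M) => //.
  by move=> n; apply: measurableT_comp.
have e : (fun n => \int[m1]_x (w1 x * g n (Y1 x))) =
    (fun n => \int[m2]_x (w2 x * g n (Y2 x))).
  by apply/funext => n; exact: same_sfun.
by rewrite -(cvg_lim (@Rhausdorff R) c1) e (cvg_lim (@Rhausdorff R) c2).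
Qed.

(** Laws may carry signed weights: if two weighted laws [w1 dm1] and [w2 dm2],
    transported by [Y1] and [Y2], agree on measurable sets, then they agree on
    bounded measurable functions. *)
Lemma same_weighted_law (f : E -> R) : bounded_mfun f ->
  \int[m1]_x (w1 x * f (Y1 x)) = \int[m2]_x (w2 x * f (Y2 x)).
Proof.
move=> bf; have [mf [M fM]] := bf.
have bM : bounded_mfun (fun _ : E => `|M|) by exact: bounded_mfun_cst.
have bfM := bounded_mfunD bf bM.
have H d3 (T3 : measurableType d3) (m3 : {measure set T3 -> \bar R})
    (w3 : T3 -> R) (Y3 : T3 -> E) : m3.-integrable setT (EFin \o w3) ->
    measurable_fun setT Y3 -> \int[m3]_x (w3 x * f (Y3 x)) =
    \int[m3]_x (w3 x * (f (Y3 x) + `|M|)) -  \int[m3]_x (w3 x * `|M|).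
  move=> iw3 mY3; rewrite -RintegralB//.
  - by apply: eq_Rintegral => x _; rewrite -mulrBr addrK.
  - apply: integrableM_bounded => //; exact: (bounded_mfun_comp mY3 bfM).
  - apply: integrableM_bounded => //; exact: (bounded_mfun_comp mY3 bM).
(* Adding a bound of [f] makes it nonnegative. *)
rewrite (H _ _ _ _ _ iw1 mY1) (H _ _ _ _ _ iw2 mY2); congr (_ - _).
- apply: (same_ge0 _ bfM) => x.
  by rewrite -lerBlDr sub0r (le_trans _ (lerNnormlW (fM x)))// lerN2 ler_norm.
- by apply: (same_ge0 _ bM) => x.
Qed.

End same_weighted_law.

Section Fubini_bounded.
Context {R : realType} {d1 d2} {T1 : measurableType d1} {T2 : measurableType d2}
  (m1 : {finite_measure set T1 -> \bar R})
  (m2 : {finite_measure set T2 -> \bar R}).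

Variable f : T1 * T2 -> R.
Hypothesis bf : bounded_mfun f.

Let integrable_prod : (m1 \x m2)%E.-integrable setT (EFin \o f).
Proof.
have [mf [M fM]] := bf.
apply: measurable_bounded_integrable => //.
  rewrite -setXTT /= product_measure1E//.
  rewrite -ge0_fin_numE ?mule_ge0//.
  by rewrite fin_numM// fin_num_measure.
exists M; split; first exact: num_real.
by move=> x Mx y _; exact: le_trans (fM y) (ltW Mx).
Qed.

Let bounded_mfun_section_r x : bounded_mfun (fun y => f (x, y)).
Proof.
by have [mf [M fM]] := bf; split; [exact: measurableT_comp | exists M].
Qed.

Let bounded_mfun_section_l y : bounded_mfun (fun x => f (x, y)).
Proof.
by have [mf [M fM]] := bf; split; [exact: measurableT_comp | exists M].
Qed.

Lemma bounded_mfun_Rintegral : bounded_mfun (fun x => \int[m2]_y f (x, y)).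
Proof.
split.
  apply: (measurableT_comp (f := fine)); first exact: fine_measurable.
  exact: measurable_fubini_F integrable_prod.
have [mf [M fM]] := bf.
exists (M * fine (m2 setT)) => x.
have ix : m2.-integrable setT (EFin \o (fun y => f (x, y))).
  exact: bounded_mfun_integrable.
rewrite (le_trans (le_normr_Rintegral measurableT ix))//.
rewrite -Rintegral_cst//; apply: le_Rintegral => //.
  exact: integrable_norm.
by apply: bounded_mfun_integrable; exact: bounded_mfun_cst.
Qed.

Lemma Rintegral_Fubini :
  \int[m1]_x (\int[m2]_y f (x, y)) = \int[m2]_y (\int[m1]_x f (x, y)).
Proof.
transitivity (fine (\int[m1]_x \int[m2]_y (f (x, y))%:E)%E).
  congr fine; apply: eq_integral => x _; rewrite fineK//.
  exact: (integrable_fin_num measurableT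
  (bounded_mfun_integrable _ (bounded_mfun_section_r x))).
rewrite (Fubini integrable_prod).
congr fine; apply: eq_integral => y _; rewrite fineK//.
exact: (integrable_fin_num measurableT
  (bounded_mfun_integrable _ (bounded_mfun_section_l y))).
Qed.

End Fubini_bounded.

(** * The binomial series of exponent at most one *)

Section binomial_series.
Context {R : realType} (al : R).
Hypothesis al01 : 0 < al <= 1.

(** The coefficient of [x ^+ k] in the expansion of [(1 - x) `^ al]. *)
Fixpoint binom_coef (k : nat) : R :=
  if k is j.+1 then binom_coef j * (j%:R - al) / j.+1%:R else 1.

Definition binom_psum (K : nat) (x : R) : R :=
  \sum_(k < K.+1) binom_coef k * x ^+ k.

(* The factor [(al - K) b_K] of [x ^+ K] in the residual of the differential
   equation [(1 - x) y' + al y = 0] at the partial sum of order [K]. *)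
Let resid_range K : 0 <= (al - K%:R) * binom_coef K <= 1.
Proof.
elim: K => [|K /andP[IH0 IH1]].
  by move: al01; rewrite /= subr0 mulr1 => /andP[/ltW-> ->].
have K0 : (0 : R) < K.+1%:R by rewrite ltr0n.
have -> : (al - K.+1%:R) * binom_coef K.+1 =
    ((K.+1%:R - al) / K.+1%:R) * ((al - K%:R) * binom_coef K).
  by rewrite /=; field; rewrite lt0r_neq0.
have c0 : 0 <= (K.+1%:R - al) / K.+1%:R.
  rewrite divr_ge0 ?ler0n// subr_ge0; case/andP: al01 => _ /le_trans; apply.
  by rewrite ler1n.
rewrite mulr_ge0//= mulr_ile1//.
by rewrite ler_pdivrMr// mul1r gerBl; case/andP: al01 => /ltW.
Qed.

Lemma binom_coef_le0 k : binom_coef k.+1 <= 0.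
Proof.
have /andP[h _] := resid_range k.
rewrite /= ler_pdivrMr ?ltr0n// mul0r -oppr_ge0 -mulrN opprB mulrC//.
Qed.

(* The partial sums solve this differential equation up to one monomial. *)
Let binom_psum_derive K (x : R) : exists D : R,
  is_derive x 1 (binom_psum K) D /\
  (1 - x) * D + al * binom_psum K x = (al - K%:R) * binom_coef K * x ^+ K.
Proof.
elim: K => [|K [D [HD HE]]].
  exists 0; split; last by rewrite /binom_psum big_ord1/= subr0; ring.
  rewrite (_ : binom_psum 0 = cst 1); first exact: is_derive_cst.
  by apply/funext => y; rewrite /binom_psum big_ord1/= mul1r.
exists (D + binom_coef K.+1 * (K.+1%:R * x ^+ K)); split.
  rewrite (_ : binom_psum K.+1 =
      binom_psum K + (fun y => binom_coef K.+1 * y ^+ K.+1)); last first.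
    by apply/funext => y; rewrite /binom_psum big_ord_recr.
  apply: is_deriveD.
  have -> : (fun y : R => binom_coef K.+1 * y ^+ K.+1) =
      binom_coef K.+1 *: ((@id R) ^+ K.+1).
    by apply/funext => y; rewrite fctE.
  have H := is_deriveZ (binom_coef K.+1) (is_deriveX K.+1 (is_derive_id x 1)).
  by apply: (is_derive_eq H); rewrite /GRing.scale/= mulr1.
rewrite [binom_psum K.+1 x]/binom_psum big_ord_recr -/(binom_psum K x).
have -> : binom_psum K x =
    (((al - K%:R) * binom_coef K * x ^+ K) - (1 - x) * D) / al.
  by rewrite -HE; field; rewrite lt0r_neq0//; case/andP: al01.
have K0 : (K.+1%:R : R) != 0 by rewrite pnatr_eq0.
rewrite exprS /= -addn1 natrD.
have K1 : (K%:R + 1 : R) != 0 by rewrite -natr1 in K0.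
by field; rewrite K1 lt0r_neq0//; case/andP: al01.
Qed.

(** The quotient of the partial sum by [(1 - x) `^ al] has a derivative that is
    geometrically small on [[0, x]], by the differential equation above, so the
    mean value theorem bounds its distance to its value 1 at 0. *)
Lemma binom_psum_cvg x : 0 <= x < 1 ->
  binom_psum K x @[K --> \oo] --> (1 - x) `^ al.
Proof.
move=> /andP[x0 x1].
have x1' : 0 < 1 - x by rewrite subr_gt0.
set C := (1 - x) `^ al * (1 - x) `^ (- al - 1).
have bnd K : `|binom_psum K x - (1 - x) `^ al| <= C * x ^+ K.
  pose h y := binom_psum K y * (1 - y) `^ (- al).
  pose dh y := (1 - y) `^ (- al - 1) * ((al - K%:R) * binom_coef K * y ^+ K).
  have hd y : y \in `[0, x] -> is_derive y 1 h (dh y).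
    rewrite in_itv/= => /andP[y0 yx].
    have y1 : 0 < 1 - y by rewrite subr_gt0 (le_lt_trans yx).
    have [D [HD HE]] := binom_psum_derive K y.
    have Hp := is_derive1_powR (- al) y1.
    have Hs : is_derive y 1 (fun y : R => 1 - y) (-1).
      have H := is_deriveB (is_derive_cst (1 : R) y 1) (is_derive_id y (1 : R)).
      by apply: (is_derive_eq H); rewrite sub0r.
    have Hc := @is_derive1_comp _ (@powR R ^~ (- al)) (fun y : R => 1 - y) y
      _ _ Hp Hs.
    have Hm := is_deriveM HD Hc.
    apply: (is_derive_eq Hm) => /=.
    have -> : (1 - y) `^ (- al) = (1 - y) `^ (- al - 1) * (1 - y).
      rewrite -[X in _ * X]powRr1 ?(ltW y1)// -powRD ?subrK//.
      by rewrite (gt_eqF y1) implybT.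
    by rewrite /dh -HE /GRing.scale/=; ring.
  have [c] : exists2 c, c \in `[0, x] & h x - h 0 = dh c * (x - 0).
    have hoo y : y \in `]0, x[ -> is_derive y 1 h (dh y).
      by move=> y0x; apply: hd; exact: subset_itv_oo_cc y0x.
    have hc : {within `[0, x], continuous h}.
      by apply: derivable_within_continuous => y /hd [].
    exact: (@MVT_segment R h dh 0 x x0 hoo hc).
  rewrite in_itv/= subr0 => /andP[c0 cx].
  have -> : h 0 = 1.
    rewrite /h subr0 powR1 mulr1 /binom_psum big_ord_recl/= mulr1 big1 ?addr0//.
    by move=> i _; rewrite expr0n/= mulr0.
  move=> hE.
  have -> : binom_psum K x - (1 - x) `^ al = (1 - x) `^ al * (dh c * x).
    rewrite -hE /h mulrBr mulr1 mulrCA -powRD ?addrN ?powRr0 ?mulr1//.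
    by rewrite (gt_eqF x1') implybT.
  rewrite normrM ger0_norm ?powR_ge0// /C -mulrA ler_wpM2l ?powR_ge0//.
  have /andP[r0 r1] := resid_range K.
  have dh0 : 0 <= dh c by rewrite mulr_ge0 ?powR_ge0// mulr_ge0// exprn_ge0.
  rewrite ger0_norm; last exact: mulr_ge0.
  rewrite -[leRHS]mulr1 ler_pM//; last exact: ltW.
  rewrite ler_pM// ?powR_ge0//; first by rewrite mulr_ge0// exprn_ge0.
    rewrite -[_ - 1]opprK opprB opprK !powRN lef_pV2 ?posrE ?powR_gt0 ?subr_gt0
      ?(le_lt_trans cx)//.
    apply: ge0_ler_powR;
      rewrite ?nnegrE ?subr_ge0 ?(ltW x1) ?(le_trans cx (ltW x1))//.
      by rewrite addr_ge0//; case/andP: al01 => /ltW.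
    by rewrite lerD2l lerN2.
  by rewrite -[leRHS]mul1r ler_pM// ?exprn_ge0// lerXn2r.
apply/cvgrPdist_le => e e0.
have cv : C * x ^+ K @[K --> \oo] --> 0.
  rewrite -[X in _ --> X](mulr0 C); apply: cvgM; first exact: cvg_cst.
  by apply: cvg_expr; rewrite ger0_norm.
near=> K; rewrite distrC (le_trans (bnd K))//.
near: K; move/cvgr0_norm_le : cv => /(_ _ e0); apply: filterS => K.
exact: le_trans (ler_norm _).
Unshelve. all: by end_near. Qed.

End binomial_series.

(** * Positive definite functions and multipliers *)

Section dotv_theory.
Context {R : realType} {d : nat}.
Implicit Types s t x y : 'rV[R]_d.

Lemma measurable_dotv t : measurable_fun setT (dotv t).
Proof.
apply: measurable_sum => i; apply: measurable_funM => //.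
exact: measurable_rV_coord.
Qed.

Lemma dotvDl s t x : dotv (s + t) x = dotv s x + dotv t x.
Proof.
by rewrite /dotv -big_split; apply: eq_bigr => i _; rewrite mxE mulrDl.
Qed.

Lemma dotvZl (a : R) t x : dotv (a *: t) x = a * dotv t x.
Proof.
by rewrite /dotv mulr_sumr; apply: eq_bigr => i _; rewrite mxE mulrA.
Qed.

Lemma dotvNl t x : dotv (- t) x = - dotv t x.
Proof. by rewrite -scaleN1r dotvZl mulN1r. Qed.

Lemma dotv0l x : dotv 0 x = 0.
Proof. by rewrite /dotv big1// => i _; rewrite mxE mul0r. Qed.

Lemma dotvC x y : dotv x y = dotv y x.
Proof. by apply: eq_bigr => i _; rewrite mulrC. Qed.

End dotv_theory.

Section positive_definite.
Context {R : realType} {d : nat} {d'} {T : measurableType d'}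
  (P : probability T R) {J : finType} (c : J -> R) (W : J -> T -> 'rV[R]_d).
Hypothesis mW : forall j, measurable_fun setT (W j).
Local Notation E := 'rV[R]_d.
Implicit Types g h : E -> R.

(** Integration against the signed combination, with weights [c j], of the laws
    of the random vectors [W j]. *)
Definition lin_expect g : R := \sum_j c j * \int[P]_w g (W j w).

(** Positive definiteness relative to the signed measure above: its integral
    against [g] times any character is nonnegative.  Only even characters
    occur, so that everything is real valued. *)
Definition posdef g := bounded_mfun g /\
  forall t, 0 <= lin_expect (fun x => g x * cos (dotv t x)).

(** Functions that preserve positive definiteness by multiplication. *)
Definition posdef_multiplier h := bounded_mfun h /\
  forall g, posdef g -> posdef (fun x => g x * h x).

Let bW g j : bounded_mfun g ->
  P.-integrable setT (EFin \o (fun w => g (W j w))).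
Proof.
by move=> bg; apply: bounded_mfun_integrable; exact: (bounded_mfun_comp (mW j)).
Qed.

Let bcos t : bounded_mfun (fun x : E => cos (dotv t x)).
Proof. by apply: bounded_mfun_cos; exact: measurable_dotv. Qed.

Lemma lin_expectD g h : bounded_mfun g -> bounded_mfun h ->
  lin_expect (fun x => g x + h x) = lin_expect g + lin_expect h.
Proof.
move=> bg bh; rewrite /lin_expect -big_split/=; apply: eq_bigr => j _.
by rewrite -mulrDr RintegralD//; exact: bW.
Qed.

Lemma lin_expectZ a g : bounded_mfun g ->
  lin_expect (fun x => a * g x) = a * lin_expect g.
Proof.
move=> bg; rewrite /lin_expect mulr_sumr/=; apply: eq_bigr => j _.
by rewrite RintegralZl//; [rewrite mulrCA|exact: bW].
Qed.

Lemma lin_expect_lim (g_ : nat -> E -> R) g M :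
  (forall n, measurable_fun setT (g_ n)) -> (forall n x, `|g_ n x| <= M) ->
  (forall x, g_ ^~ x @ \oo --> g x) ->
  lin_expect (g_ n) @[n --> \oo] --> lin_expect g.
Proof.
move=> mg gM cg; apply: cvg_big => [|j _]; first exact: add_continuous.
apply: cvgM; first exact: cvg_cst.
apply: (@Rintegral_dominated _ _ _ _ _ _ (fun=> M)).
- by move=> n; apply: measurableT_comp.
- by move=> w; exact: cg.
- by apply: bounded_mfun_integrable; exact: bounded_mfun_cst.
- by move=> n w.
Qed.

Lemma multiplier_cst a : 0 <= a -> posdef_multiplier (fun=> a).
Proof.
move=> a0; split; first exact: bounded_mfun_cst.
move=> g [bg pg]; split.
  by apply: bounded_mfunM => //; exact: bounded_mfun_cst.
move=> t; have := lin_expectZ a (bounded_mfunM bg (bcos t)).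
rewrite (_ : (fun x => g x * a * _) = fun x => a * (g x * cos (dotv t x))).
  by move=> ->; exact: mulr_ge0.
by apply/funext => x; rewrite mulrAC mulrC.
Qed.

Lemma multiplierD g h : posdef_multiplier g -> posdef_multiplier h ->
  posdef_multiplier (fun x => g x + h x).
Proof.
move=> [bg Hg] [bh Hh]; split; first exact: bounded_mfunD.
move=> f pf; have [bfg pfg] := Hg _ pf; have [bfh pfh] := Hh _ pf.
split; first by apply: bounded_mfunM; [case: pf|exact: bounded_mfunD].
move=> t.
have := lin_expectD (bounded_mfunM bfg (bcos t)) (bounded_mfunM bfh (bcos t)).
rewrite (_ : (fun x => f x * g x * _ + _) =
    fun x => f x * (g x + h x) * cos (dotv t x)).
  by move=> ->; exact: addr_ge0.
by apply/funext => x; rewrite -mulrDl mulrDr.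
Qed.

Lemma multiplierM g h : posdef_multiplier g -> posdef_multiplier h ->
  posdef_multiplier (fun x => g x * h x).
Proof.
move=> [bg Hg] [bh Hh]; split; first exact: bounded_mfunM.
move=> f pf; have := Hh _ (Hg _ pf).
by under eq_fun do rewrite -mulrA.
Qed.

Lemma multiplierX h n : posdef_multiplier h ->
  posdef_multiplier (fun x => h x ^+ n).
Proof.
move=> Hh; elim: n => [|n IH]; first exact: multiplier_cst.
by under eq_fun do rewrite exprS; exact: multiplierM.
Qed.

Lemma multiplier_sum n (h : nat -> E -> R) :
  (forall i, posdef_multiplier (h i)) ->
  posdef_multiplier (fun x => \sum_(i < n) h i x).
Proof.
move=> Hh; elim: n => [|n IH].
  by under eq_fun do rewrite big_ord0; exact: multiplier_cst.
by under eq_fun do rewrite big_ord_recr; exact: multiplierD.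
Qed.

(** By the product formula
    [2 cos u cos v = cos (u + v) + cos (u - v)]. *)
Lemma multiplier_cos s : posdef_multiplier (fun x => cos (dotv s x)).
Proof.
split; first exact: bcos.
move=> g [bg pg]; split; first exact: bounded_mfunM.
move=> t.
have h r : bounded_mfun (fun x => 2^-1 * (g x * cos (dotv r x))).
  by apply: bounded_mfunM; [exact: bounded_mfun_cst|exact: bounded_mfunM].
rewrite (_ : (fun x => _) = fun x => 2^-1 * (g x * cos (dotv (s + t) x)) +
    2^-1 * (g x * cos (dotv (s - t) x))).
  rewrite lin_expectD// !lin_expectZ; try exact: bounded_mfunM.
  by rewrite addr_ge0// mulr_ge0// invr_ge0.
by apply/funext => x; rewrite !dotvDl dotvNl cosD cosB; field.
Qed.

Lemma multiplier_lim (h_ : nat -> E -> R) h M :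
  (forall n, posdef_multiplier (h_ n)) -> (forall n x, `|h_ n x| <= M) ->
  (forall x, h_ ^~ x @ \oo --> h x) -> posdef_multiplier h.
Proof.
move=> Hh hM ch; have mh n : measurable_fun setT (h_ n) by case: (Hh n) => -[].
have bh := bounded_mfun_lim mh hM ch.
split => // g pg; have [[mg [M' gM']] _] := pg.
split; first by apply: bounded_mfunM => //; case: pg.
move=> t.
have c1 : lin_expect (fun x => g x * h_ n x * cos (dotv t x)) @[n --> \oo] -->
    lin_expect (fun x => g x * h x * cos (dotv t x)).
  apply: (@lin_expect_lim _ _ (M' * M * 1)).
  - move=> n; apply: measurable_funM; last by case: (bcos t).
    exact: measurable_funM.
  - move=> n x; rewrite !normrM; apply: ler_pM => //; first by apply: ler_pM.
    exact: cos_max.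
  - move=> x; apply: cvgM; last exact: cvg_cst.
    by apply: cvgM; [exact: cvg_cst|exact: ch].
apply: (cvgr_to_ge c1); near=> n.
by have [_ H] := Hh n; have [_] := H _ pg; exact.
Unshelve. all: by end_near. Qed.

Lemma multiplier_expR h : posdef_multiplier h ->
  posdef_multiplier (fun x => expR (h x)).
Proof.
move=> Hh; have [[mh [M hM]] _] := Hh.
apply: (@multiplier_lim (fun n x => \sum_(i < n) (i`!%:R)^-1 * h x ^+ i) _
  (expR `|M|)).
- move=> n; apply: (@multiplier_sum _ (fun i x => (i`!%:R)^-1 * h x ^+ i)) => i.
  by apply: multiplierM; [apply: multiplier_cst|exact: multiplierX].
- move=> n x; apply: (@le_trans _ _ (series (exp_coeff `|M|) n)).
    rewrite /series/= big_mkord (le_trans (ler_norm_sum _ _ _))//.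
    apply: ler_sum => i _.
    rewrite exp_coeffE normrM ger0_norm// ler_wpM2l// normrX.
    by rewrite lerXn2r ?nnegrE// (le_trans (hM x))// ler_norm.
  apply: nondecreasing_cvgn_le; last exact: is_cvg_series_exp_coeff.
  apply/nondecreasing_seqP => k; rewrite /series/= big_nat_recr//= lerDl.
  by rewrite exp_coeffE mulr_ge0// exprn_ge0.
- move=> x; rewrite (_ : (fun n => _) = series (exp_coeff (h x))); last first.
    by apply/funext => n; rewrite exp_coeffE /series/= big_mkord.
  exact: is_cvg_series_exp_coeff.
Qed.

(** A mixture of multipliers is a multiplier, by Fubini's theorem. *)
Lemma multiplier_mix {dU} {U : measurableType dU}
    (nu : {finite_measure set U -> \bar R}) (h : E * U -> R) :
  bounded_mfun h -> (forall u, posdef_multiplier (fun x => h (x, u))) ->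
  posdef_multiplier (fun x => \int[nu]_u h (x, u)).
Proof.
move=> bh Hh; have bi : bounded_mfun (fun x => \int[nu]_u h (x, u)).
  exact: (@bounded_mfun_Rintegral _ _ _ _ _ \d_(0 : E) nu).
split => // g pg; have bg : bounded_mfun g by case: pg.
split; first exact: bounded_mfunM.
move=> t.
pose f j (z : T * U) :=
  g (W j z.1) * h (W j z.1, z.2) * cos (dotv t (W j z.1)).
have bf j : bounded_mfun (f j).
  have m1 : measurable_fun setT (fun z : T * U => W j z.1).
    by apply: (measurableT_comp (mW j)).
  have m2 : measurable_fun setT (fun z : T * U => (W j z.1, z.2)).
    exact/measurable_fun_pair.
  apply: bounded_mfunM; last exact: (bounded_mfun_comp m1 (bcos t)).
  apply: bounded_mfunM; first exact: (bounded_mfun_comp m1).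
  exact: (bounded_mfun_comp m2 bh).
have biP j : bounded_mfun (fun u => \int[P]_w f j (w, u)).
  have msw : measurable_fun setT (fun z : U * T => (z.2, z.1)).
    exact/measurable_fun_pair.
  exact: (@bounded_mfun_Rintegral _ _ _ _ _ nu P _
    (bounded_mfun_comp msw (bf j))).
have bhx x : bounded_mfun (fun u => h (x, u)).
  by apply: (bounded_mfun_comp _ bh).
rewrite (_ : lin_expect _ = \int[nu]_u \sum_j c j * \int[P]_w f j (w, u)).
  apply: Rintegral_ge0 => u _.
  by have [_ H] := Hh u; have [_] := H _ pg; exact.
rewrite Rintegral_sum; last first.
  move=> j; apply: bounded_mfun_integrable; apply: bounded_mfunM.
    exact: bounded_mfun_cst.
  exact: biP.
apply: eq_bigr => j _; rewrite RintegralZl//; last first.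
  by apply: bounded_mfun_integrable; exact: biP.
rewrite -Rintegral_Fubini; last exact: bf.
congr (_ * _).
apply: eq_Rintegral => w _; rewrite /f/=.
rewrite -[RHS]/(\int[nu]_y (g (W j w) * h (W j w, y) * cos (dotv t (W j w)))).
have ih : nu.-integrable setT (EFin \o (fun u => h (W j w, u))).
  exact: bounded_mfun_integrable.
rewrite RintegralZr//; last first.
  have := integrableZl measurableT (g (W j w)) ih; exact.
by rewrite RintegralZl.
Qed.

End positive_definite.

(** * Approximation of powers of the square *)

Section approx_square.
Context {R : realType}.
Implicit Types (s x a l : R) (m : nat).

Lemma sin_mean_value x : 0 <= x -> exists2 c, 0 <= c <= x & sin x = cos c * x.
Proof.
move=> x0.
have hd (y : R) : y \in `]0, x[ -> is_derive y 1 sin (cos y).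
  by move=> _; exact: is_derive_sin.
have hc : {within `[0, x], continuous (@sin R)}.
  by apply: continuous_subspaceT; exact: continuous_sin.
have [c] := @MVT_segment R sin cos 0 x x0 hd hc.
by rewrite in_itv/= sin0 !subr0 => ? ?; exists c.
Qed.

Lemma powR_cvg (u : nat -> R) a l : 0 < a -> (forall n, 0 <= u n) ->
  u n @[n --> \oo] --> l -> u n `^ a @[n --> \oo] --> l `^ a.
Proof.
move=> a0 u0 ul.
have : 0 <= l by apply: (cvgr_to_ge ul); near=> n; exact: u0.
rewrite le_eqVlt => /predU1P[l0|l0]; last first.
  apply: (cvg_comp u (fun x : R => x `^ a) ul).
  have /derivable1_diffP/differentiable_continuous :
      derivable (@powR R ^~ a) l 1.
    by apply: derivable_powR; rewrite in_itv/= l0.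
  exact.
rewrite -l0 powR0 ?gt_eqF//.
apply/cvgr0Pnorm_le => e e0.
have ea0 : 0 < e `^ a^-1 by exact: powR_gt0.
move: ul; rewrite -l0 => /cvgr0Pnorm_le /(_ _ ea0); apply: filterS => n.
rewrite !ger0_norm ?powR_ge0// => une.
rewrite -[leRHS]powRr1 ?(ltW e0)// -[X in e `^ X](@mulVf _ a) ?gt_eqF// powRrM.
apply: ge0_ler_powR => //; first exact: ltW.
- by rewrite nnegrE.
- by rewrite nnegrE powR_ge0.
Unshelve. all: by end_near. Qed.

(** A factor less than 1 that tends to 1 fast enough for [approx_sq] to tend to
    the square, and keeps the argument of the binomial series below 1. *)
Definition damping m : R := 1 - (4 * m.+1%:R ^+ 3)^-1.

(** A cosine rescaled to range over [[0, 1]], where the binomial series has all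
    its terms of the same sign. *)
Definition cos_weight m s : R := (1 + cos (s / m.+1%:R)) / 2.

(** [4 M^2 (1 - damping * cos_weight)] with [M = m + 1]; without the damping it
    is [(2 M sin (s / 2M)) ^ 2]. *)
Definition approx_sq m s : R :=
  4 * m.+1%:R ^+ 2 * (1 - damping m * cos_weight m s).

Lemma damping_itv m : 0 <= damping m < 1.
Proof.
have M1 : (1 : R) <= m.+1%:R ^+ 3 by rewrite exprn_ege1// ler1n.
rewrite /damping subr_ge0 invf_le1 ?mulr_gt0 ?(lt_le_trans ltr01 M1)//.
rewrite ltrBlDr ltrDl invr_gt0 mulr_gt0 ?(lt_le_trans ltr01 M1)// andbT.
lra.
Qed.

Lemma cos_weight_itv m s : 0 <= cos_weight m s <= 1.
Proof.
rewrite /cos_weight.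
have := cos_geN1 (s / m.+1%:R); have := cos_le1 (s / m.+1%:R).
by move=> *; apply/andP; split; lra.
Qed.

Let approx_sqE m s : exists2 c : R, 0 <= c <= `|s| / 2 / m.+1%:R &
  approx_sq m s = cos c ^+ 2 * s ^+ 2 + cos_weight m s / m.+1%:R.
Proof.
have M0 : (0 : R) < m.+1%:R by [].
have y0 : 0 <= `|s| / 2 / m.+1%:R by rewrite !divr_ge0.
have [c c0 sc] := sin_mean_value y0; exists c => //.
have cE : cos (s / m.+1%:R) = 1 - 2 * (cos c * (`|s| / 2 / m.+1%:R)) ^+ 2.
  rewrite -sc -[LHS]cos_norm normrM [`|_^-1|]ger0_norm//.
  have -> : `|s| / m.+1%:R = (`|s| / 2 / m.+1%:R) *+ 2.
    by rewrite mulr2n; field; rewrite gt_eqF.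
  by rewrite cos_mulr2n cos2sin2 mulr2n; ring.
rewrite /approx_sq /damping /cos_weight cE.
rewrite -[X in _ = _ * X + _]real_normK ?num_real//.
by field; rewrite gt_eqF.
Qed.

Lemma approx_sq_ge0 m s : 0 <= approx_sq m s.
Proof.
have [c _ ->] := approx_sqE m s; have /andP[w0 _] := cos_weight_itv m s.
by rewrite addr_ge0// mulr_ge0 ?sqr_ge0.
Qed.

Lemma approx_sq_le m s : approx_sq m s <= s ^+ 2 + 1.
Proof.
have [c _ ->] := approx_sqE m s; have /andP[w0 w1] := cos_weight_itv m s.
apply: lerD; first by rewrite -[leRHS]mul1r ler_wpM2r ?sqr_ge0.
by rewrite ler_pdivrMr// mul1r (le_trans w1)// ler1n.
Qed.

Lemma approx_sq_cvg s : approx_sq m s @[m --> \oo] --> s ^+ 2.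
Proof.
pose c m := s2val (cid2 (approx_sqE m s)).
have c_itv m : 0 <= c m <= `|s| / 2 / m.+1%:R := s2valP (cid2 (approx_sqE m s)).
have cE m :
    approx_sq m s = cos (c m) ^+ 2 * s ^+ 2 + cos_weight m s / m.+1%:R :=
  s2valP' (cid2 (approx_sqE m s)).
have h0 : (m.+1%:R)^-1 @[m --> \oo] --> (0 : R) by exact: cvg_harmonic.
have c0 : c m @[m --> \oo] --> 0.
  apply: (@squeeze_cvgr _ _ _ _ (fun=> 0) (fun m => `|s| / 2 / m.+1%:R)).
  - by near=> m; exact: c_itv.
  - exact: cvg_cst.
  - rewrite -[X in _ --> X](mulr0 (`|s| / 2)); apply: cvgM => //.
    exact: cvg_cst.
have w0 : cos_weight m s / m.+1%:R @[m --> \oo] --> 0.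
  apply: (@squeeze_cvgr _ _ _ _ (fun=> 0) (fun m => m.+1%:R^-1)) => //.
  - near=> m; have /andP[w0 w1] := cos_weight_itv m s.
    by rewrite divr_ge0//= ler_piMl.
  - exact: cvg_cst.
have cc : cos (c m) @[m --> \oo] --> (1 : R).
  by rewrite -cos0; apply: continuous_cvg => //; exact: continuous_cos.
have : cos (c m) * cos (c m) * s ^+ 2 + cos_weight m s / m.+1%:R @[m --> \oo]
    --> 1 * 1 * s ^+ 2 + 0.
  by apply: cvgD => //; apply: cvgM; [exact: cvgM|exact: cvg_cst].
rewrite !mul1r addr0; apply: cvg_trans; apply: near_eq_cvg; near=> m.
by rewrite cE expr2.
Unshelve. all: by end_near. Qed.

(** The domination used to pass to the limit under the integral sign. *)
Lemma approx_sq_powR_le m s a : 0 < a <= 1 ->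
  approx_sq m s `^ a <= 2 * `|s| `^ (2 * a) + 2.
Proof.
move=> /andP[a0 a1].
have sq : `|s| `^ (2 * a) = (s ^+ 2) `^ a.
  by rewrite powRrM powR_mulrn// real_normK// num_real.
have pow2 : (2 : R) `^ a <= 2 by rewrite -[leRHS]powRr1// ler_powR// ler1n.
have h : approx_sq m s `^ a <= (s ^+ 2 + 1) `^ a.
  by rewrite ge0_ler_powR ?nnegrE ?approx_sq_ge0 ?approx_sq_le ?addr_ge0
    ?sqr_ge0 ?(ltW a0).
rewrite (le_trans h)// sq; have [s1|s1] := leP (s ^+ 2) 1.
  apply: (@le_trans _ _ 2); last by rewrite lerDr mulr_ge0// powR_ge0.
  apply: le_trans pow2.
  rewrite ge0_ler_powR ?nnegrE ?addr_ge0 ?sqr_ge0 ?(ltW a0)//.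
  lra.
apply: (@le_trans _ _ (2 * (s ^+ 2) `^ a)); last by rewrite lerDl.
apply: (@le_trans _ _ ((2 * s ^+ 2) `^ a)).
  have s0 := sqr_ge0 s.
  by apply: ge0_ler_powR; rewrite ?nnegrE ?(ltW a0)//; lra.
by rewrite powRM ?sqr_ge0// ler_wpM2r// powR_ge0.
Qed.

Lemma bounded_mfun_cos_weight {dT} {T : measurableType dT} m (f : T -> R) :
  measurable_fun setT f -> bounded_mfun (fun w => cos_weight m (f w)).
Proof.
move=> mf; apply: bounded_mfunM; last exact: bounded_mfun_cst.
apply: bounded_mfunD; first exact: bounded_mfun_cst.
by apply: bounded_mfun_cos; apply: measurable_funM.
Qed.

End approx_square.

(** * Exponentials of L_p norms are multipliers *)

Section exp_multiplier.
Context {R : realType} {d : nat} {d'} {T : measurableType d'}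
  (P : probability T R) {J : finType} (c : J -> R) (W : J -> T -> 'rV[R]_d).
Hypothesis mW : forall j, measurable_fun setT (W j).
Local Notation multiplier := (posdef_multiplier P c W).
Variable a : R.
Hypothesis a01 : 0 < a <= 1.

Lemma multiplier_binomial (z : 'rV[R]_d -> R) (rho : R) :
  0 <= rho < 1 -> (forall x, 0 <= z x <= 1) -> multiplier z ->
  multiplier (fun x => 1 - (1 - rho * z x) `^ a).
Proof.
move=> /andP[rho0 rho1] z01 mz.
have rz x : 0 <= rho * z x < 1.
  have /andP[z0 z1] := z01 x; rewrite mulr_ge0//=.
  by rewrite (le_lt_trans _ rho1)// ler_piMr.
pose S K x := \sum_(k < K) - binom_coef a k.+1 * (rho * z x) ^+ k.+1.
have SE K x : S K x = 1 - binom_psum a K (rho * z x).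
  rewrite /S /binom_psum big_ord_recl/= mulr1 opprD addrA subrr add0r.
  by rewrite -sumrN; apply: eq_bigr => i _; rewrite mulNr.
have Sc x : S K x @[K --> \oo] --> 1 - (1 - rho * z x) `^ a.
  under eq_fun do rewrite SE.
  by apply: cvgB; [exact: cvg_cst|exact: binom_psum_cvg].
have t0 k x : 0 <= - binom_coef a k.+1 * (rho * z x) ^+ k.+1.
  rewrite mulr_ge0 ?oppr_ge0 ?(binom_coef_le0 a01)// exprn_ge0//.
  by case/andP: (rz x).
apply: (@multiplier_lim _ _ _ _ P _ c W mW S _ 1).
- move=> K; apply: (@multiplier_sum _ _ _ _ _ _ _ _ mW K
    (fun k x => - binom_coef a k.+1 * (rho * z x) ^+ k.+1)) => k.
  apply: multiplierM.
    by apply: (multiplier_cst P c mW); rewrite oppr_ge0 (binom_coef_le0 a01).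
  apply: (multiplierX mW); apply: multiplierM => //.
  exact: (multiplier_cst P c mW).
- move=> K x; rewrite ger0_norm ?sumr_ge0//.
  apply: (@le_trans _ _ (1 - (1 - rho * z x) `^ a)).
    rewrite -(cvg_lim _ (Sc x))//; apply: nondecreasing_cvgn_le.
      apply/nondecreasing_seqP => k.
      by rewrite /S [leRHS]big_ord_recr lerDl; exact: t0.
    by apply/cvg_ex; eexists; exact: Sc.
  by rewrite gerBl powR_ge0.
- exact: Sc.
Qed.

Lemma multiplier_cos_weight m s :
  multiplier (fun x => cos_weight m (dotv s x)).
Proof.
rewrite (_ : (fun x => _) =
    fun x => 2^-1 * (1 + cos (dotv (m.+1%:R^-1 *: s) x))).
  apply: multiplierM; first by apply: (multiplier_cst P c mW).
  apply: (multiplierD mW); first exact: (multiplier_cst P c mW).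
  exact: multiplier_cos.
apply/funext => x.
by rewrite /cos_weight dotvZl [LHS]mulrC [_^-1 * dotv _ _]mulrC.
Qed.

Context {dU} {U : measurableType dU} (nu : {finite_measure set U -> \bar R})
  (sg : U -> 'rV[R]_d).
Hypothesis msg : measurable_fun setT sg.
Hypothesis isg : forall x,
  nu.-integrable setT (EFin \o (fun u => `|dotv x (sg u)| `^ (2 * a))).

Let m_dotv : measurable_fun setT (fun z : 'rV[R]_d * U => dotv z.1 (sg z.2)).
Proof.
apply: measurable_sum => i; apply: measurable_funM.
  exact: (measurableT_comp (measurable_rV_coord i)).
apply: (measurableT_comp (measurable_rV_coord i)).
exact: (measurableT_comp msg).
Qed.

Let h m (z : 'rV[R]_d * U) : R :=
  1 - (1 - damping m * cos_weight m (dotv z.1 (sg z.2))) `^ a.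

Let dw m (s : R) : 0 <= 1 - damping m * cos_weight m s <= 1.
Proof.
have /andP[r0 r1] := @damping_itv R m; have /andP[w0 w1] := cos_weight_itv m s.
by rewrite subr_ge0 mulr_ile1 ?(ltW r1)//= gerBl mulr_ge0.
Qed.

Let bh m : bounded_mfun (h m).
Proof.
apply: bounded_mfunB; first exact: bounded_mfun_cst.
split.
  apply: (measurableT_comp (f := fun y : R => y `^ a)).
    exact: measurable_powR.
  apply: measurable_funB => //; apply: measurable_funM => //.
  by have [] := bounded_mfun_cos_weight m m_dotv.
exists 1 => z; rewrite ger0_norm ?powR_ge0//.
have /andP[w0 w1] := dw m (dotv z.1 (sg z.2)).
have /andP[a0 _] := a01.
apply: (@le_trans _ _ (1 `^ a)); last by rewrite powR1.
by apply: ge0_ler_powR; rewrite ?nnegrE ?(ltW a0).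
Qed.

(** With [C = l (4 M^2)^a], the exponential of [- l] times the integral of
    [approx_sq ^ a] is [exp (- C nu(U))] times the exponential of a mixture of
    the multipliers [1 - (1 - damping * cos_weight)^a]. *)
Lemma multiplier_exp_dotv (l : R) : 0 <= l ->
  multiplier (fun x => expR (- l * \int[nu]_u `|dotv x (sg u)| `^ (2 * a))).
Proof.
move=> l0; have /andP[a0 _] := a01.
pose C m := l * (4 * m.+1%:R ^+ 2) `^ a.
pose G m x := expR (- (C m * fine (nu setT))) *
  expR (C m * \int[nu]_u h m (x, u)).
have bhx m x : bounded_mfun (fun u => h m (x, u)).
  exact: (bounded_mfun_comp _ (bh m)).
have iA m x : nu.-integrable setT
    (EFin \o (fun u => approx_sq m (dotv x (sg u)) `^ a)).
  rewrite (_ : (fun u => _) =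
      fun u => (4 * m.+1%:R ^+ 2) `^ a * (1 - h m (x, u))); last first.
    apply/funext => u.
    rewrite /h /approx_sq subKr -powRM ?mulr_ge0 ?exprn_ge0//=.
    by case/andP: (dw m (dotv x (sg u))).
  apply: bounded_mfun_integrable; apply: bounded_mfunM.
    exact: bounded_mfun_cst.
  by apply: bounded_mfunB => //; exact: bounded_mfun_cst.
have GE m x : G m x = expR (- l * \int[nu]_u approx_sq m (dotv x (sg u)) `^ a).
  rewrite /G -expRD; congr expR.
  rewrite -[X in - _ + X]opprK -opprD mulNr; congr (- _).
  rewrite -mulrBr /C -mulrA; congr (l * _).
  rewrite -[fine _]mul1r -Rintegral_cst// -RintegralB//; last 2 first.
  - by apply: bounded_mfun_integrable; exact: bounded_mfun_cst.
  - by apply: bounded_mfun_integrable.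
  rewrite -RintegralZl//; last first.
    apply: bounded_mfun_integrable; apply: bounded_mfunB => //.
    exact: bounded_mfun_cst.
  apply: eq_Rintegral => u _; rewrite /h /approx_sq subKr/=.
  rewrite -powRM ?mulr_ge0 ?exprn_ge0//.
  by case/andP: (dw m (dotv x (sg u))).
apply: (@multiplier_lim _ _ _ _ P _ c W mW G _ 1).
- move=> m; apply: multiplierM.
    by apply: (multiplier_cst P c mW); exact: expR_ge0.
  apply: (multiplier_expR mW); apply: multiplierM.
    by apply: (multiplier_cst P c mW); rewrite mulr_ge0// powR_ge0.
  apply: (multiplier_mix mW) => // u; apply: multiplier_binomial.
  - exact: damping_itv.
  - by move=> x; exact: cos_weight_itv.
  - by under eq_fun do rewrite /= dotvC; exact: multiplier_cos_weight.
- move=> m x; rewrite GE ger0_norm ?expR_ge0// -[leRHS]expR0 ler_expR.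
  by rewrite mulNr oppr_le0 mulr_ge0// Rintegral_ge0// => u _; exact: powR_ge0.
- move=> x; under eq_fun do rewrite GE.
  apply: continuous_cvg; first exact: continuous_expR.
  apply: cvgM; first exact: cvg_cst.
  apply: (@Rintegral_dominated _ _ _ _ _ _
    (fun u => 2 * `|dotv x (sg u)| `^ (2 * a) + 2)).
  + by move=> m; have := measurable_int _ (iA m x) => /measurable_EFinP.
  + move=> u; have -> : `|dotv x (sg u)| `^ (2 * a) = (dotv x (sg u) ^+ 2) `^ a.
      by rewrite powRrM powR_mulrn// real_normK// num_real.
    apply: powR_cvg => //; first by move=> m; exact: approx_sq_ge0.
    exact: approx_sq_cvg.
  + have i2 : nu.-integrable setT (EFin \o (fun=> 2 : R)).
      by apply: bounded_mfun_integrable; exact: bounded_mfun_cst.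
    have := integrableD measurableT (integrableZl measurableT 2 (isg x)) i2.
    exact.
  + by move=> m u; rewrite ger0_norm ?powR_ge0// approx_sq_powR_le.
Qed.

End exp_multiplier.

(** * Independence and characteristic functions *)

Section independence.
Context {R : realType} {d : nat} {d'} {T : measurableType d'}
  (P : probability T R) {I : finType} (X : I -> {RV P >-> 'rV[R]_d}).
Hypothesis indX : independent_RVs X.
Local Notation E := 'rV[R]_d.

Let mX i : measurable_fun setT (X i). Proof. by []. Qed.

Let bX i (f : E -> R) : bounded_mfun f -> bounded_mfun (fun w => f (X i w)).
Proof. by move=> bf; exact: (bounded_mfun_comp (mX i) bf). Qed.

Let Rintegral_indicX i (A : set E) : measurable A ->
  \int[P]_w (\1_A (X i w) : R) = fine (P (X i @^-1` A)).
Proof.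
move=> mA; have mXA : measurable (X i @^-1` A).
  by rewrite -[X in measurable X]setTI; exact: mX.
by rewrite /Rintegral -(setIT (X i @^-1` A)) -integral_indic.
Qed.

(** Independence is given on sets; the indicators are replaced by bounded
    measurable functions one index at a time, with [same_weighted_law]. *)
Lemma Rintegral_prod_independent (f : I -> E -> R) :
  (forall i, bounded_mfun (f i)) ->
  \int[P]_w (\prod_i f i (X i w)) = \prod_i \int[P]_w f i (X i w).
Proof.
(* The factors whose index lies outside [r] are still indicators. *)
have H (r : seq I) : forall g : I -> E -> R, (forall i, bounded_mfun (g i)) ->
    (forall i, i \notin r -> exists2 A, measurable A & g i = \1_A) ->
    \int[P]_w (\prod_i g i (X i w)) = \prod_i \int[P]_w g i (X i w).
  elim: r => [|k r IH] g bg gA.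
    pose A i := s2val (cid2 (gA i isT)).
    have mA i : measurable (A i) := s2valP (cid2 (gA i isT)).
    have gE i : g i = \1_(A i) := s2valP' (cid2 (gA i isT)).
    have indA := indX [set: I]%SET mA.
    have e1 : \int[P]_w (\prod_i g i (X i w)) =
        fine (P (\bigcap_(i in [set` [set: I]%SET]) X i @^-1` A i)).
      have mB : measurable (\bigcap_(i in [set` [set: I]%SET]) X i @^-1` A i).
        apply: fin_bigcap_measurable => // i _.
        by rewrite -[X in measurable X]setTI; exact: mX.
      rewrite -(setIT (\bigcap_(i in _) _)) -integral_indic//.
      apply: eq_Rintegral => w _; rewrite indicE.
      have [h|/existsNP[i hi]] := pselect (forall i, A i (X i w)).
        rewrite mem_set; last by move=> i _; exact: h.
        by rewrite big1// => i _; rewrite gE indicE mem_set.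
      rewrite memNset; last by move=> /(_ i); rewrite /= inE => /(_ isT).
      by rewrite (bigD1 i)//= gE indicE memNset// mul0r.
    rewrite e1 indA (eq_bigr (fun i => (\int[P]_w g i (X i w))%:E)).
      by rewrite prodEFin/=; apply: eq_bigl => i; rewrite inE.
    move=> i _; rewrite gE Rintegral_indicX// fineK// fin_num_measure//.
    by rewrite -[X in measurable X]setTI; exact: mX.
  have [kr|kr] := boolP (k \in r).
    apply: IH => // i ir; apply: gA; rewrite inE negb_or ir andbT.
    by apply: contra ir => /eqP ->.
  rewrite [RHS](bigD1 k)//= mulrC.
  transitivity (\int[P]_w ((\prod_(i | i != k) g i (X i w)) * g k (X k w))).
    by apply: eq_Rintegral => w _; rewrite (bigD1 k)//= mulrC.
  pose c := \prod_(i | i != k) \int[P]_w g i (X i w).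
  have bp : bounded_mfun (fun w => \prod_(i | i != k) g i (X i w)).
    by apply: bounded_mfun_prod => i; exact: bX.
  transitivity (\int[P]_w (c * g k (X k w))); last first.
    by rewrite RintegralZl//; apply: bounded_mfun_integrable; exact: bX.
  apply: (same_weighted_law _ _ (mX k) (mX k)) => //.
  - exact: bounded_mfun_integrable.
  - by apply: bounded_mfun_integrable; exact: bounded_mfun_cst.
  - move=> A mA; pose g' i := if i == k then \1_A else g i.
    have g'k : g' k = \1_A by rewrite /g' eqxx.
    have g'i i : i != k -> g' i = g i by rewrite /g' => /negbTE ->.
    have := IH g'; rewrite [in RHS](bigD1 k)//= g'k => IHk.
    rewrite RintegralZl//; last first.
      by apply: bounded_mfun_integrable; apply: bX; exact: bounded_mfun_indic.
    rewrite /c mulrC; transitivity (\int[P]_w (\prod_i g' i (X i w))).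
      apply: eq_Rintegral => w _; rewrite [RHS](bigD1 k)//= g'k mulrC.
      by congr (_ * _); apply: eq_bigr => i ik; rewrite g'i.
    rewrite IHk.
    + by congr (_ * _); apply: eq_bigr => i ik; rewrite g'i.
    + by move=> i; rewrite /g'; case: ifP => // _; exact: bounded_mfun_indic.
    + move=> i ir; have [->|ik] := eqVneq i k; first by exists A.
      by rewrite g'i//; apply: gA; rewrite inE negb_or ik.
move=> bf; apply: (H (index_enum I)) => // i.
by rewrite mem_index_enum.
Qed.

(** The addition formulas for cosine and sine separate one index at a time; the
    induction carries arbitrary factors at the remaining indices. *)
Lemma Rintegral_cos_sum_independent (t : I -> E) :
  (forall i, \int[P]_w sin (dotv (t i) (X i w)) = 0) ->
  \int[P]_w cos (\sum_i dotv (t i) (X i w)) =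
  \prod_i \int[P]_w cos (dotv (t i) (X i w)).
Proof.
move=> Esin.
pose C i (x : E) : R := cos (dotv (t i) x).
pose S i (x : E) : R := sin (dotv (t i) x).
have bC i : bounded_mfun (C i).
  by apply: bounded_mfun_cos; exact: measurable_dotv.
have bS i : bounded_mfun (S i).
  by apply: bounded_mfun_sin; exact: measurable_dotv.
have mdX i : measurable_fun setT (fun w => dotv (t i) (X i w)).
  by apply: measurableT_comp => //; exact: measurable_dotv.
have H (r : seq I) : uniq r -> forall f : I -> E -> R,
    (forall i, bounded_mfun (f i)) ->
    \int[P]_w (cos (\sum_(i <- r) dotv (t i) (X i w)) *
      \prod_(i | i \notin r) f i (X i w)) =
    \prod_(i <- r) \int[P]_w C i (X i w) *
      \prod_(i | i \notin r) \int[P]_w f i (X i w) /\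
    \int[P]_w (sin (\sum_(i <- r) dotv (t i) (X i w)) *
      \prod_(i | i \notin r) f i (X i w)) = 0.
  elim: r => [_|k r IH /= /andP[kr ur]] f bf.
    rewrite big_nil mul1r -Rintegral_prod_independent//; split.
      by apply: eq_Rintegral => w _; rewrite big_nil cos0 mul1r.
    under eq_Rintegral => w _ do rewrite big_nil sin0 mul0r.
    by rewrite Rintegral_cst// mul0r.
  pose fk (g : E -> R) i := if i == k then g else f i.
  have bfk g : bounded_mfun g -> forall i, bounded_mfun (fk g i).
    by move=> bg i; rewrite /fk; case: ifP.
  have rE (g : E -> R) w : \prod_(i | i \notin r) fk g i (X i w) =
      g (X k w) * \prod_(i | i \notin k :: r) f i (X i w).
    rewrite (bigD1 k)//= {1}/fk eqxx; congr (_ * _).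
    apply: eq_big => [i|i /andP[_ /negbTE ik]]; last by rewrite /fk ik.
    by rewrite inE negb_or andbC.
  have rE' (g : E -> R) : \prod_(i | i \notin r) \int[P]_w fk g i (X i w) =
      (\int[P]_w g (X k w)) * \prod_(i | i \notin k :: r) \int[P]_w f i (X i w).
    rewrite (bigD1 k)//= {1}/fk eqxx; congr (_ * _).
    apply: eq_big => [i|i /andP[_ /negbTE ik]]; last by rewrite /fk ik.
    by rewrite inE negb_or andbC.
  have [IHcc IHsc] := IH ur _ (bfk _ (bC k)).
  have [IHcs IHss] := IH ur _ (bfk _ (bS k)).
  have msum : measurable_fun setT (fun w => \sum_(i <- r) dotv (t i) (X i w)).
    exact: measurable_sum.
  have icos g : bounded_mfun g -> P.-integrable setT (EFin \o
      (fun w => cos (\sum_(i <- r) dotv (t i) (X i w)) *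
        \prod_(i | i \notin r) fk g i (X i w))).
    move=> bg; apply: bounded_mfun_integrable; apply: bounded_mfunM.
      exact: bounded_mfun_cos.
    by apply: bounded_mfun_prod => i; apply: bX; exact: bfk.
  have isin g : bounded_mfun g -> P.-integrable setT (EFin \o
      (fun w => sin (\sum_(i <- r) dotv (t i) (X i w)) *
        \prod_(i | i \notin r) fk g i (X i w))).
    move=> bg; apply: bounded_mfun_integrable; apply: bounded_mfunM.
      exact: bounded_mfun_sin.
    by apply: bounded_mfun_prod => i; apply: bX; exact: bfk.
  pose CC g := \int[P]_w (cos (\sum_(i <- r) dotv (t i) (X i w)) *
    \prod_(i | i \notin r) fk g i (X i w)).
  pose SS g := \int[P]_w (sin (\sum_(i <- r) dotv (t i) (X i w)) *
    \prod_(i | i \notin r) fk g i (X i w)).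
  split.
    transitivity (CC (C k) - SS (S k)).
      rewrite -RintegralB//; [|exact: icos|exact: isin].
      by apply: eq_Rintegral => w _; rewrite big_cons !rE /C /S cosD; ring.
    by rewrite /CC /SS IHcc IHss subr0 big_cons rE' mulrA [X in X * _ = _]mulrC.
  transitivity (CC (S k) + SS (C k)).
    rewrite -RintegralD//; [|exact: icos|exact: isin].
    by apply: eq_Rintegral => w _; rewrite big_cons !rE /C /S sinD; ring.
  by rewrite /CC /SS IHcs IHsc rE' Esin mul0r mulr0 addr0.
have [+ _] := H _ (index_enum_uniq I) C bC.
have p1 (F : I -> R) : \prod_(i | i \notin index_enum I) F i = 1.
  by apply: big_pred0 => i; rewrite mem_index_enum.
rewrite p1 mulr1 => <-; apply: eq_Rintegral => w _.
by rewrite p1 mulr1.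
Qed.

End independence.

Section characteristic_function.
Context {R : realType} {d : nat} {d'} {T : measurableType d'}
  (P : probability T R) (psi : 'rV[R]_d -> R).

Lemma Rintegral_density (Y : {RV P >-> 'rV[R]_d}) (f : 'rV[R]_d -> R) :
  has_density Y psi -> bounded_mfun f ->
  \int[P]_w f (Y w) = \int[lebesgue_rV d]_y (psi y * f y).
Proof.
move=> [mpsi psi0 law] bf.
have mY : measurable_fun setT Y by [].
have ipsi : (lebesgue_rV d).-integrable setT (EFin \o psi).
  apply/integrableP; split; first exact/measurable_EFinP.
  under eq_integral => x _ do rewrite /= ger0_norm//.
  rewrite -law//; exact: (le_lt_trans (probability_le1 _ _) (ltry 1)).
transitivity (\int[P]_w (1 * f (Y w))).
  by apply: eq_Rintegral => w _; rewrite mul1r.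
apply: (@same_weighted_law _ _ _ _ _ _ _ P (lebesgue_rV d)
  (fun=> 1) psi Y id) => //.
- by apply: bounded_mfun_integrable; exact: bounded_mfun_cst.
- move=> A mA; transitivity (fine (distribution P Y A)).
    have mYA : measurable (Y @^-1` A).
      by rewrite -[X in measurable X]setTI; exact: mY.
    rewrite /distribution /= /pushforward.
    rewrite -(setIT (Y @^-1` A)) -integral_indic//.
    by apply: eq_Rintegral => w _; rewrite mul1r.
  rewrite law// /Rintegral; congr fine; rewrite [LHS]integral_mkcond.
  apply: eq_integral => x _; rewrite /= patchE indicE.
  by case: (x \in A); rewrite ?mulr1 ?mulr0.
Qed.

Context {n : nat} (X : 'I_n -> {RV P >-> 'rV[R]_d}) (q : R).
Hypothesis indX : independent_RVs X.
Hypothesis densX : forall i, has_density (X i) psi.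
Hypothesis fourier_ge0 : forall x, 0 <= fourier psi x.

Let fourier_cos i t :
  \int[P]_w cos (dotv t (X i w)) = complex.Re (fourier psi ((2 * pi)^-1 *: t)).
Proof.
rewrite (@Rintegral_density _ (fun x => cos (dotv t x)) (densX i))//;
  last first.
  by apply: bounded_mfun_cos; exact: measurable_dotv.
apply: eq_Rintegral => y _.
by rewrite dotvZl mulrA divff ?mul1r ?cosN// mulf_neq0// gt_eqF// pi_gt0.
Qed.

Let fourier_sin i t : \int[P]_w sin (dotv t (X i w)) = 0.
Proof.
rewrite (@Rintegral_density _ (fun x => sin (dotv t x)) (densX i))//;
  last first.
  by apply: bounded_mfun_sin; exact: measurable_dotv.
have := fourier_ge0 ((2 * pi)^-1 *: - t); rewrite lecE => /andP[/eqP im0 _].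
rewrite -[RHS]im0; apply: eq_Rintegral => y _.
rewrite dotvZl mulrA divff ?mul1r ?dotvNl ?opprK//.
by rewrite mulf_neq0// gt_eqF// pi_gt0.
Qed.

Lemma Rintegral_cos_weighted_sum (t : 'rV[R]_d) (a : 'rV[R]_n) :
  \int[P]_w cos (dotv t (weighted_sum X q a w)) =
  \prod_i complex.Re (fourier psi (a ord0 i `^ q^-1 *: ((2 * pi)^-1 *: t))).
Proof.
transitivity (\prod_i \int[P]_w cos (dotv (a ord0 i `^ q^-1 *: t) (X i w))).
  rewrite -Rintegral_cos_sum_independent//.
  apply: eq_Rintegral => w _; congr cos; rewrite /weighted_sum dotvC.
  rewrite (big_morph (dotv^~ t) (fun x y => dotvDl x y t) (dotv0l t)).
  by apply: eq_bigr => i _; rewrite dotvZl dotvC -dotvZl.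
by apply: eq_bigr => i _; rewrite fourier_cos !scalerA mulrC.
Qed.

End characteristic_function.

(** * Majorization *)

Section majorization.
Context {R : realType}.
Implicit Types (s x y : seq R).

Lemma sum_nth_oversize s k : (size s <= k)%N ->
  \sum_(j < k) s`_j = \sum_(z <- s) z.
Proof.
elim: s k => [k _|z s IH [//|k] sk].
  by rewrite big_nil big1// => j _; rewrite nth_nil.
by rewrite big_ord_recl big_cons /= -(IH k).
Qed.

Lemma sum_nth_le s k c : 0 <= c -> all (<= c) s ->
  \sum_(j < k) s`_j <= k%:R * c.
Proof.
move=> c0 sc; rewrite mulr_natl -[k in leRHS]card_ord -sumr_const.
apply: ler_sum => j _.
have [js|js] := ltnP j (size s); last by rewrite nth_default.
by have /allP := sc; apply; exact: mem_nth.
Qed.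

Lemma sum_le_size s c : all (<= c) s -> \sum_(z <- s) z <= (size s)%:R * c.
Proof.
elim: s => [|z s IH] /=; first by rewrite big_nil mul0r.
by move=> /andP[zc sc]; rewrite big_cons -natr1 mulrDl mul1r addrC lerD ?IH.
Qed.

Lemma path_ge_all (z : R) s : path >=%R z s -> all (<= z) s.
Proof.
by rewrite path_sortedE; [case/andP|move=> ? ? ? /[swap]; exact: le_trans].
Qed.

Lemma size_last_le_sum (z : R) s : path >=%R z s ->
  (size s).+1%:R * last z s <= z + \sum_(t <- s) t.
Proof.
elim: s z => [|w s IH] z pzs; first by rewrite big_nil mul1r addr0.
have /allP zs := path_ge_all pzs; have /andP[_ pws] := pzs.
rewrite big_cons -natr1 mulrDl mul1r addrC lerD//; last exact: IH.
by apply: zs; rewrite /= mem_last.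
Qed.

(* The relation [le] stands for the order or for its converse, so that the
   log-convex and the log-concave case are treated together. *)
Variables (le : R -> R -> Prop) (phi : R -> R).
Hypotheses (lexx' : forall x : R, le x x)
  (letr : forall y x z : R, le x y -> le y z -> le x z)
  (le_mul : forall c x y : R, 0 <= c -> le x y -> le (c * x) (c * y)).
Hypothesis phi_ge0 : forall z, 0 <= z -> 0 <= phi z.
Hypothesis transfer : forall a b u v, 0 <= b -> b <= u <= a -> u + v = a + b ->
  le (phi u * phi v) (phi a * phi b).

Let prod_phi_ge0 s : all (>= 0) s -> 0 <= \prod_(z <- s) phi z.
Proof.
elim: s => [_|z s IH /= /andP[z0 s0]]; first by rewrite big_nil.
by rewrite big_cons mulr_ge0 ?phi_ge0 ?IH.
Qed.

(* Removes from a decreasing list the value [t] after one transfer: if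
   [y_k >= t >= y_(k+1)], the pair [(y_k, y_(k+1))] becomes
   [(t, y_k + y_(k+1) - t)].  In the last clause, a prefix that reaches the new
   entry has sum that of the longer old prefix minus [t], and a shorter prefix
   only has entries that are at least [t]. *)
Let remove_part (t z : R) (y : seq R) : path >=%R z y -> all (>= 0) (z :: y) ->
  t <= z -> last z y <= t ->
  exists y', [/\ path >=%R z y', all (>= 0) y', size y' = size y,
    \sum_(w <- y') w = \sum_(w <- z :: y) w - t &
    le (phi t * \prod_(w <- y') phi w) (\prod_(w <- z :: y) phi w) /\
    forall k, \sum_(j < k) y'`_j = \sum_(j < k.+1) (z :: y)`_j - t \/
      k%:R * t <= \sum_(j < k) y'`_j].
Proof.
elim: y z => [|z2 y IH] z /=.
  move=> _ _ tz zt; have {zt}-> : t = z by apply/eqP; rewrite eq_le tz.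
  exists [::]; split => //=; first by rewrite big_nil big_seq1 subrr.
  split; first by rewrite big_nil big_seq1 mulr1.
  move=> k; left; rewrite big_ord_recl/=.
  by rewrite !big1 ?addr0 ?subrr// => j _; rewrite nth_nil.
move=> /andP[z2z pz2] /and3P[z0 z20 y0] tz lt.
have [z2t|tz2] := leP z2 t.
  exists ((z + z2 - t) :: y); split => //=.
  - apply/andP; split; first lra.
    case: y pz2 {IH y0 lt} => //= w y /andP[wz2 ->]; rewrite andbT; lra.
  - by rewrite y0 andbT; lra.
  - by rewrite !big_cons; ring.
  split.
    rewrite !big_cons !mulrA mulrC [X in le _ X]mulrC.
    apply: le_mul; first exact: prod_phi_ge0.
    by apply: transfer => //; [rewrite z2t tz|ring].
  case=> [|k]; first by right; rewrite big_ord0 mul0r.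
    by left; rewrite !big_ord_recl/=; ring.
have [|y' [py' y'0 sy' sumy' [ley' pref]]] := IH z2 pz2 _ (ltW tz2) lt.
  by rewrite /= z20.
exists (z :: y'); split => //=.
- apply/andP; split => //.
  case: y' py' {y'0 sy' sumy' ley' pref} => //= w y' /andP[wz2 ->].
  by rewrite (le_trans wz2).
- by rewrite z0.
- by rewrite sy'.
- by rewrite !big_cons sumy' big_cons; ring.
split.
  rewrite big_cons mulrCA [X in le _ X]big_cons; apply: le_mul => //.
  exact: phi_ge0.
case=> [|k]; first by right; rewrite big_ord0 mul0r.
  have [e|e] := pref k; [left|right].
    by rewrite [LHS]big_ord_recl/= e [in RHS]big_ord_recl/=; ring.
  by rewrite big_ord_recl/= -natr1 mulrDl mul1r [leLHS]addrC lerD.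
Qed.

(** Karamata's inequality in product form.  Nothing is required of [phi] apart
    from nonnegativity and the inequality for a transfer between two
    coordinates; in particular [phi] may vanish. *)
Lemma prod_majorized_seq x y : sorted >=%R x -> sorted >=%R y ->
  all (>= 0) y -> size x = size y ->
  (forall k, \sum_(j < k) x`_j <= \sum_(j < k) y`_j) ->
  \sum_(z <- x) z = \sum_(z <- y) z ->
  le (\prod_(z <- x) phi z) (\prod_(z <- y) phi z).
Proof.
elim: x y => [|t x IH] [|z y] px py y0 sxy // pref sumxy.
move: px py sxy => /= px py [sxy].
have tz : t <= z by have := pref 1%N; rewrite !big_ord1.
have xt := path_ge_all px.
have last0 : 0 <= last z y by have /allP := y0; apply; exact: mem_last.
have lt : last z y <= t.
  have S0 : (0 : R) < (size y).+1%:R by rewrite ltr0n.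
  rewrite -(ler_pM2l S0) (le_trans (size_last_le_sum py))//.
  have -> : z + \sum_(w <- y) w = \sum_(w <- t :: x) w.
    by rewrite sumxy big_cons.
  rewrite -sxy; apply: (sum_le_size (s := t :: x)).
  by rewrite /= lexx.
have t0 : 0 <= t by exact: le_trans lt.
have [y' [py' y'0 sy' sumy' [ley' pref']]] := remove_part py y0 tz lt.
apply: (letr _ ley'); rewrite big_cons; apply: le_mul; first exact: phi_ge0.
apply: IH => //.
- exact: path_sorted px.
- exact: path_sorted py'.
- by rewrite sxy sy'.
- move=> k; have := pref k.+1; rewrite big_ord_recl/= => prefk.
  have [->|] := pref' k; first by rewrite lerBrDl.
  by apply: le_trans; exact: sum_nth_le.
- by rewrite sumy' -sumxy big_cons; ring.
Qed.

Lemma prod_majorized n (x y : 'rV[R]_n) : (forall i, 0 <= y ord0 i) ->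
  majorized x y -> le (\prod_i phi (x ord0 i)) (\prod_i phi (y ord0 i)).
Proof.
move=> y0 [pref sumxy].
pose r (z : 'rV[R]_n) := decreasing_rearrangement z.
have size_r z : size (r z) = n by rewrite size_sort size_map size_enum_ord.
have perm_r z : perm_eq (r z) [seq z ord0 i | i <- enum 'I_n].
  by rewrite perm_sort.
have sum_r z : \sum_(w <- r z) w = \sum_i z ord0 i.
  by rewrite (perm_big _ (perm_r z)) big_map big_enum.
have prod_r z : \prod_(w <- r z) phi w = \prod_i phi (z ord0 i).
  by rewrite (perm_big _ (perm_r z)) big_map big_enum.
have sorted_r z : sorted >=%R (r z).
  by apply: sort_sorted => a b; exact: ge_total.
rewrite -!prod_r; apply: prod_majorized_seq => //.
- rewrite (perm_all _ (perm_r y)) all_map; apply/allP => i _; exact: y0.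
- by rewrite !size_r.
- move=> k; have [->|k0] := posnP k; first by rewrite !big_ord0.
  have [kn|nk] := ltnP k n; first by apply: pref; rewrite k0.
  by rewrite !sum_nth_oversize ?size_r// !sum_r sumxy.
- by rewrite !sum_r.
Qed.

End majorization.

(** * Log-convexity *)

Section log_convexity.
Context {R : realType}.
Implicit Types (u v l s : R).

Lemma powR_split u l : 0 <= u -> u `^ l * u `^ (1 - l) = u.
Proof. by move=> u0; rewrite -powRD ?subrKC ?powRr1// oner_eq0. Qed.

Lemma powR_prod (I : Type) (r : seq I) (F : I -> R) l : (forall i, 0 <= F i) ->
  (\prod_(i <- r) F i) `^ l = \prod_(i <- r) F i `^ l.
Proof.
move=> F0; elim: r => [|i r IH]; first by rewrite !big_nil powR1.
by rewrite !big_cons powRM ?IH// prodr_ge0.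
Qed.

Lemma transfer_convex_comb a b u v : b < u < a -> u + v = a + b ->
  exists l, [/\ 0 < l < 1, u = l * a + (1 - l) * b & v = l * b + (1 - l) * a].
Proof.
move=> /andP[bu ua] uv; have ab : 0 < a - b by lra.
exists ((u - b) / (a - b)); split.
- apply/andP; split; first by rewrite divr_gt0// subr_gt0.
  by rewrite ltr_pdivrMr// mul1r ltrD2r.
- by field; rewrite gt_eqF.
- have -> : v = a + b - u by rewrite -uv; ring.
  by field; rewrite gt_eqF.
Qed.

Lemma log_convex_transfer (f : R^o -> R) :
  log_convex ([set s | 0 <= s] : set R^o) f ->
  forall a b u v : R, 0 <= b -> b <= u <= a -> u + v = a + b ->
  f u * f v <= f a * f b.
Proof.
move=> [f0 fc] a b u v b0 /andP[bu ua] uv.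
move: bu; rewrite le_eqVlt => /predU1P[bu|bu].
  have -> : v = a by lra.
  by rewrite bu mulrC.
move: ua; rewrite le_eqVlt => /predU1P[ua|ua].
  have -> : v = b by lra.
  by rewrite ua.
have a0 : 0 <= a by lra.
have buaP : b < u < a by rewrite bu ua.
have [l [l01 -> ->]] := transfer_convex_comb buaP uv.
have h1 := fc a b l a0 b0 l01; have h2 := fc b a l b0 a0 l01.
have v0 : 0 <= l *: (b : R^o) + (1 - l) *: (a : R^o).
  by rewrite /GRing.scale/= addr_ge0 ?mulr_ge0//; case/andP: l01 => *; lra.
have u0 : 0 <= l *: (a : R^o) + (1 - l) *: (b : R^o).
  by rewrite /GRing.scale/= addr_ge0 ?mulr_ge0//; case/andP: l01 => *; lra.
apply: (le_trans (ler_pM (f0 _ u0) (f0 _ v0) h1 h2)).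
rewrite [X in _ * X]mulrC mulrACA powR_split ?f0//.
by rewrite [_ * f b `^ l]mulrC powR_split ?f0.
Qed.

Lemma log_concave_transfer (f : R^o -> R) :
  log_concave ([set s | 0 <= s] : set R^o) f ->
  forall a b u v : R, 0 <= b -> b <= u <= a -> u + v = a + b ->
  f a * f b <= f u * f v.
Proof.
move=> [f0 fc] a b u v b0 /andP[bu ua] uv.
move: bu; rewrite le_eqVlt => /predU1P[bu|bu].
  have -> : v = a by lra.
  by rewrite bu mulrC.
move: ua; rewrite le_eqVlt => /predU1P[ua|ua].
  have -> : v = b by lra.
  by rewrite ua.
have a0 : 0 <= a by lra.
have buaP : b < u < a by rewrite bu ua.
have [l [l01 -> ->]] := transfer_convex_comb buaP uv.
have h1 := fc a b l a0 b0 l01; have h2 := fc b a l b0 a0 l01.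
have p0 x y k : 0 <= f x `^ k * f y `^ (1 - k) by rewrite mulr_ge0 ?powR_ge0.
apply: le_trans (ler_pM (p0 _ _ _) (p0 _ _ _) h1 h2).
rewrite [X in _ <= _ * X]mulrC mulrACA powR_split ?f0//.
by rewrite [_ * f b `^ l]mulrC powR_split ?f0.
Qed.

Lemma weighted_AMGM u v s l : 0 <= u -> 0 <= v -> 0 < s -> 0 < l < 1 ->
  u `^ l * v `^ (1 - l) <= l * s `^ (1 - l) * u + (1 - l) * s `^ (- l) * v.
Proof.
move=> u0 v0 s0 /andP[l0 l1].
have l1' : 0 < 1 - l by rewrite subr_gt0.
have := @conjugate_powR _
  ((s `^ (1 - l) * u) `^ l) ((s `^ (- l) * v) `^ (1 - l))
  l^-1 (1 - l)^-1 (powR_ge0 _ _) (powR_ge0 _ _).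
rewrite !invr_gt0 !invrK subrKC => /(_ l0 l1' erefl).
rewrite -!powRrM !mulfV ?gt_eqF// !powRr1 ?mulr_ge0 ?powR_ge0//.
rewrite !powRM ?powR_ge0// mulrACA -!powRrM -powRD; last first.
  by rewrite (gt_eqF s0) implybT.
rewrite (_ : (1 - l) * l + - l * (1 - l) = 0); last by ring.
by rewrite powRr0 mul1r => /le_trans; apply; lra.
Qed.

(** The weighted geometric mean is the least of its tangent planes; the
    minimum is attained at [s = v / u]. *)
Lemma geometric_mean_tangent u v w l : 0 < u -> 0 < v -> 0 < l < 1 ->
  (forall s, 0 < s -> w <= l * s `^ (1 - l) * u + (1 - l) * s `^ (- l) * v) ->
  w <= u `^ l * v `^ (1 - l).
Proof.
move=> u0 v0 l01 /(_ (v / u)); rewrite divr_gt0// => /(_ isT) h.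
apply: (le_trans h); rewrite le_eqVlt; apply/orP; left; apply/eqP.
have uN : u `^ l * u `^ (1 - l) = u by exact: powR_split (ltW u0).
have vN : v `^ l * v `^ (1 - l) = v by exact: powR_split (ltW v0).
have e1 : (v / u) `^ (1 - l) * u = u `^ l * v `^ (1 - l).
  rewrite powRM ?invr_ge0 ?ltW// -powR_inv1 ?ltW// -powRrM mulN1r powRN.
  rewrite -[X in _ * X]uN; field; exact: lt0r_neq0 (powR_gt0 _ u0).
have e2 : (v / u) `^ (- l) * v = u `^ l * v `^ (1 - l).
  rewrite powRM ?invr_ge0 ?ltW// -powR_inv1 ?ltW// -powRrM mulN1r opprK powRN.
  rewrite -[X in _ * X]vN; field; exact: lt0r_neq0 (powR_gt0 _ v0).
by rewrite -!mulrA e1 e2 -mulrDl subrKC mul1r.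
Qed.

Lemma prod_log_convex (f : R^o -> R) n (x y : 'rV[R]_n) l :
  log_convex ([set s | 0 <= s] : set R^o) f ->
  (forall i, 0 <= x ord0 i) -> (forall i, 0 <= y ord0 i) -> 0 < l < 1 ->
  \prod_i f ((l *: x + (1 - l) *: y) ord0 i) <=
  (\prod_i f (x ord0 i)) `^ l * (\prod_i f (y ord0 i)) `^ (1 - l).
Proof.
move=> [f0 fc] x0 y0 l01.
rewrite !powR_prod;
  [|by move=> i; apply: f0; (exact: x0 || exact: y0)..].
rewrite -big_split/=; apply: ler_prod => i _; rewrite !mxE; apply/andP; split.
  apply: f0; case/andP: l01 => l0 l1.
  by rewrite /= addr_ge0 ?mulr_ge0// ?ltW ?subr_gt0.
exact: (fc (x ord0 i) (y ord0 i) l (x0 i) (y0 i) l01).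
Qed.

End log_convexity.

(** * Embeddings in L_p *)

Section finite_lebesgue01.
Context {R : realType}.

Let lebesgue01_lty : (@lebesgue_measure R [set` `[0%R, 1%R]] < +oo)%E.
Proof. by rewrite lebesgue_measure_itv/= lte_fin ltr01 -EFinB ltry. Qed.

(** Restriction of a measure to a measurable set of finite measure. *)
Definition finite_restr {dT} {T : measurableType dT}
    (mu : {measure set T -> \bar R}) (D : set T) (mD : measurable D)
    (muD : (mu D < +oo)%E) : {finite_measure set T -> \bar R} := mfrestr mD muD.

(** [lebesgue01] with its structure of finite measure; the two are
    convertible. *)
Definition finite_lebesgue01 :
    {finite_measure set (measurableTypeR R) -> \bar R} :=
  @finite_restr _ (measurableTypeR R) lebesgue_measure _
    (measurable_itv `[0 : R, 1]) lebesgue01_lty.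

End finite_lebesgue01.

Section Lp_embedding.
Context {R : realType} {d : nat}.
Implicit Types (p : R) (N : 'rV[R]_d -> R).

(** The embedding is linear only almost everywhere, for each linear combination
    separately.  Replacing it by the combination of the images of the
    canonical basis makes it a genuine scalar product with a random vector. *)
Lemma embeds_in_Lp_integral p N : 0 < p -> embeds_in_Lp p N ->
  exists sg : measurableTypeR R -> 'rV[R]_d, [/\ measurable_fun setT sg,
    forall x, lebesgue01.-integrable setT
      (EFin \o (fun u => `|dotv x (sg u)| `^ p)) &
    forall x, N x `^ p = \int[lebesgue01]_u `|dotv x (sg u)| `^ p].
Proof.
move=> p0 [S [mS linS normS]].
pose sg u : 'rV[R]_d := \row_i S (delta_mx 0 i) u.
have msg : measurable_fun setT sg.
  apply: measurable_fun_rVP => i.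
  rewrite (_ : _ \o _ = S (delta_mx 0 i)); first exact: mS.
  by apply/funext => u; rewrite /= /rV_coord mxE.
have S0 : {ae lebesgue01, forall u, S 0 u = 0}.
  have := linS 1 0 0; apply: filterS => u.
  by rewrite scaler0 addr0 mul1r => h; lra.
have Sdot x : {ae lebesgue01, forall u, S x u = dotv x (sg u)}.
  have H (r : seq 'I_d) : {ae lebesgue01, forall u,
      S (\sum_(i <- r) x ord0 i *: delta_mx 0 i) u =
      \sum_(i <- r) x ord0 i * sg u ord0 i}.
    elim: r => [|i r IH].
      by move: S0; apply: filterS => u; rewrite !big_nil.
    rewrite big_cons; have := linS (x ord0 i) (delta_mx 0 i)
      (\sum_(i <- r) x ord0 i *: delta_mx 0 i).
    by apply: filterS2 IH => u IHu ->; rewrite big_cons IHu mxE.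
  by apply: filterS (H (index_enum _)) => u; rewrite -row_sum_delta.
have mdot x : measurable_fun setT (fun u => dotv x (sg u)).
  by apply: measurableT_comp => //; exact: measurable_dotv.
have mpow (f : measurableTypeR R -> R) : measurable_fun setT f ->
    measurable_fun setT (fun u => `|f u| `^ p).
  move=> mf; apply: (measurableT_comp (f := fun y : R => y `^ p)).
    exact: measurable_powR.
  exact: measurableT_comp.
have intS x : (\int[lebesgue01]_u (`|dotv x (sg u)| `^ p)%:E)%E = (N x `^ p)%:E.
  transitivity ((N x)%:E `^ p)%E; last by rewrite poweR_EFin.
  rewrite -(normS x) (poweR_Lnorm _ _ (lt0r_neq0 p0)).
  apply: ae_eq_integral => //.
  - by apply/measurable_EFinP; exact: mpow.
  - by apply/measurable_EFinP; exact: mpow.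
  - have := Sdot x; apply: filterS => u e _; by rewrite /= e.
exists sg; split => // x.
  apply/integrableP; split; first by apply/measurable_EFinP; exact: mpow.
  under eq_integral => u _ do rewrite /= ger0_norm ?powR_ge0//.
  by rewrite intS ltry.
by rewrite /Rintegral intS.
Qed.

End Lp_embedding.

(** * From Laplace transforms to means *)

Section laplace_to_mean.
Context {R : realType} {d'} {T : measurableType d'} (P : probability T R).

Lemma expRN_bounds (x : R) : 0 <= x -> x / (1 + x) <= 1 - expR (- x) <= x.
Proof.
move=> x0; have x1 : 0 < 1 + x by lra.
apply/andP; split; last by have := expR_ge1Dx (- x); lra.
have : expR (- x) <= (1 + x)^-1.
  by rewrite expRN lef_pV2 ?posrE ?expR_gt0// expR_ge1Dx.
have -> : x / (1 + x) = 1 - (1 + x)^-1 by field; rewrite gt_eqF.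
lra.
Qed.

Lemma difference_quotient_cvg (x : R) : 0 <= x ->
  m.+1%:R * (1 - expR (- (m.+1%:R^-1 * x))) @[m --> \oo] --> x.
Proof.
move=> x0.
have h0 : (m.+1%:R)^-1 @[m --> \oo] --> (0 : R) by exact: cvg_harmonic.
apply: (@squeeze_cvgr _ _ _ _ (fun m => x / (1 + m.+1%:R^-1 * x)) (fun=> x)).
- near=> m; have M0 : (0 : R) < m.+1%:R by [].
  set y := m.+1%:R^-1 * x; have xE : x = m.+1%:R * y.
    by rewrite mulrA divff ?mul1r// gt_eqF.
  have y0 : 0 <= y by rewrite mulr_ge0.
  have /andP[h1 h2] := expRN_bounds y0.
  apply/andP; split; first by rewrite [X in X / _]xE -mulrA ler_pM2l.
  by rewrite [leRHS]xE ler_pM2l.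
- suff : x / (1 + m.+1%:R^-1 * x) @[m --> \oo] --> x * (1 + 0 * x)^-1.
    by rewrite mul0r addr0 invr1 mulr1.
  apply: cvgM; first exact: cvg_cst.
  apply: cvgV; first by rewrite mul0r addr0 oner_eq0.
  apply: cvgD; first exact: cvg_cst.
  by apply: cvgM => //; exact: cvg_cst.
- exact: cvg_cst.
Unshelve. all: by end_near. Qed.

(** The means may be infinite. *)
Lemma le_mean_laplace (f g : T -> R) :
  measurable_fun setT f -> measurable_fun setT g ->
  (forall w, 0 <= f w) -> (forall w, 0 <= g w) ->
  (forall l : R, 0 < l ->
    \int[P]_w expR (- l * f w) <= \int[P]_w expR (- l * g w)) ->
  (\int[P]_w (g w)%:E <= \int[P]_w (f w)%:E)%E.
Proof.
move=> mf mg f0 g0 fg.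
(* The quotient [(1 - exp (- l h)) / l] for [l = 1 / (m + 1)]. *)
pose q (h : T -> R) m w := m.+1%:R * (1 - expR (- (m.+1%:R^-1 * h w))).
have q0 (h : T -> R) m w : (forall w, 0 <= h w) -> 0 <= q h m w.
  move=> h0; rewrite /q mulr_ge0// subr_ge0 -[leRHS]expR0 ler_expR oppr_le0.
  by rewrite mulr_ge0.
have bexp (h : T -> R) (l : R) :
    measurable_fun setT h -> (forall w, 0 <= h w) -> 0 < l ->
    bounded_mfun (fun w => expR (- l * h w)).
  move=> mh h0 l0; split.
    by apply: measurableT_comp => //; exact: measurable_funM.
  exists 1 => w; rewrite ger0_norm ?expR_ge0// -[leRHS]expR0 ler_expR.
  by rewrite mulNr oppr_le0 mulr_ge0// ltW.
have qE (h : T -> R) m : measurable_fun setT h -> (forall w, 0 <= h w) ->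
    (\int[P]_w (q h m w)%:E)%E =
    (m.+1%:R * (1 - \int[P]_w expR (- m.+1%:R^-1 * h w)))%:E.
  move=> mh h0; have M0 : (0 : R) < m.+1%:R^-1 by rewrite invr_gt0.
  have bq : bounded_mfun (fun w => 1 - expR (- m.+1%:R^-1 * h w)).
    by apply: bounded_mfunB; [exact: bounded_mfun_cst|exact: bexp].
  have i1 : P.-integrable setT (EFin \o (fun=> 1 : R)).
    by apply: bounded_mfun_integrable; exact: bounded_mfun_cst.
  have ie := bounded_mfun_integrable P (bexp h _ mh h0 M0).
  have e1 : \int[P]_w (1 : R) = 1.
    rewrite Rintegral_cst//; have /= -> := @probability_setT _ _ _ P.
    by rewrite mulr1.
  rewrite -[X in X - _]e1 -RintegralB// -RintegralZl//; last first.
    exact: bounded_mfun_integrable.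
  rewrite /Rintegral fineK; last first.
    apply: integrable_fin_num => //.
    have := integrableZl measurableT (m.+1%:R) (bounded_mfun_integrable P bq).
    exact.
  by apply: eq_integral => w _; rewrite /q mulNr.
have mq (h : T -> R) m : measurable_fun setT h -> measurable_fun setT (q h m).
  move=> mh; apply: measurable_funM => //; apply: measurable_funB => //.
  apply: measurableT_comp => //; apply: measurableT_comp => //.
  exact: measurable_funM.
have -> : (\int[P]_w (g w)%:E = \int[P]_w limn_einf (fun m => (q g m w)%:E))%E.
  apply: eq_integral => w _; apply/esym.
  apply: (cvg_limn_einf_sup _).1; apply: cvg_EFin; first by near=> m.
  exact: difference_quotient_cvg.
apply: (le_trans (fatou _ _ _ _)) => //.
- by move=> m; apply/measurable_EFinP; exact: mq.
- by move=> m w _; rewrite lee_fin q0.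
rewrite limn_einf_lim; apply: lime_le; first exact: is_cvg_einfs.
apply: nearW => m; apply: (@le_trans _ _ (\int[P]_w (q g m w)%:E)%E).
  by apply: ereal_inf_lbound; exists m => /=.
apply: (@le_trans _ _ (\int[P]_w (q f m w)%:E)%E).
  rewrite (qE f m mf f0) (qE g m mg g0) lee_fin ler_pM2l// lerD2l lerN2.
  by apply: fg; rewrite invr_gt0.
apply: ge0_le_integral => //.
- by move=> w _; rewrite lee_fin q0.
- by apply/measurable_EFinP; exact: mq.
- by apply/measurable_EFinP.
- move=> w _; rewrite lee_fin /q.
  have Mf0 : 0 <= m.+1%:R^-1 * f w by rewrite mulr_ge0.
  have /andP[_ h] := expRN_bounds Mf0.
  by rewrite [leLHS]mulrC -ler_pdivlMr// [leRHS]mulrC.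
Unshelve. all: by end_near. Qed.

End laplace_to_mean.

(** * The Laplace and moment functionals *)

Section laplace_functional_theory.
Context {R : realType} {d n : nat} {p q : R}
  {psi : 'rV[R]_d -> R} {N : 'rV[R]_d -> R}
  {disp : measure_display} {T : measurableType disp} {P : probability T R}
  {X : 'I_n -> {RV P >-> 'rV[R]_d}}.
Hypotheses (indX : independent_RVs X) (densX : forall i, has_density (X i) psi)
  (fourier_ge0 : forall x, 0 <= fourier psi x) (p02 : 0 < p <= 2)
  (embN : embeds_in_Lp p N).

Local Notation phi t s := (complex.Re (fourier psi (s `^ q^-1 *: t))).

Let p0 : 0 < p. Proof. by case/andP: p02. Qed.

Lemma measurable_weighted_sum a : measurable_fun setT (weighted_sum X q a).
Proof.
apply: measurable_fun_rVP => i.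
rewrite (_ : _ \o _ =
    (fun w => \sum_j a ord0 j `^ q^-1 * rV_coord i (X j w))); last first.
  apply/funext => w; rewrite /= /rV_coord /weighted_sum summxE.
  by apply: eq_bigr => j _; rewrite mxE.
apply: measurable_sum => j; apply: measurable_funM => //.
by apply: measurableT_comp => //; exact: measurable_rV_coord.
Qed.

(** The weights and random vectors are arbitrary: the multiplier property of
    [exp (- l N^p)] does not depend on the signed measure. *)
Lemma laplace_multiplier (J : finType) (c : J -> R) (W : J -> T -> 'rV[R]_d) l :
  (forall j, measurable_fun setT (W j)) -> 0 <= l ->
  posdef_multiplier P c W (fun x => expR (- l * N x `^ p)).
Proof.
move=> mW l0; have [sg [msg isg NE]] := embeds_in_Lp_integral p0 embN.
have p2 : 2 * (p / 2) = p by rewrite mulrC divfK.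
have p21 : 0 < p / 2 <= 1 by case/andP: p02 => ? ?; apply/andP; split; lra.
rewrite (_ : (fun x => _) = fun x =>
    expR (- l * \int[finite_lebesgue01]_u `|dotv x (sg u)| `^ (2 * (p / 2)))).
  by apply: multiplier_exp_dotv => // x; rewrite p2; exact: isg.
by apply/funext => x; rewrite p2 NE.
Qed.

Lemma bounded_mfun_laplace l a : 0 <= l ->
  bounded_mfun (fun w => expR (- l * N (weighted_sum X q a w) `^ p)).
Proof.
move=> l0; apply: (bounded_mfun_comp (measurable_weighted_sum a)
  (f := fun x => expR (- l * N x `^ p))).
(* Only boundedness and measurability are wanted, so the signed measure is 0. *)
have [] // := @laplace_multiplier 'I_0 (fun=> 0) (fun=> weighted_sum X q a) l
  _ l0.
by move=> j; exact: measurable_weighted_sum.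
Qed.

Lemma laplace_functionalE l a : laplace_functional X N p q l a =
  \int[P]_w expR (- l * N (weighted_sum X q a w) `^ p).
Proof. by rewrite /laplace_functional unlock. Qed.

Lemma laplace_functional_ge0 l a : 0 <= laplace_functional X N p q l a.
Proof.
by rewrite laplace_functionalE Rintegral_ge0// => w _; exact: expR_ge0.
Qed.

Lemma laplace_functional_gt0 l a : 0 <= l -> 0 < laplace_functional X N p q l a.
Proof.
move=> l0; rewrite lt_neqAle laplace_functional_ge0 andbT eq_sym.
apply/eqP; rewrite laplace_functionalE => e0.
have bl := bounded_mfun_laplace a l0.
have il := bounded_mfun_integrable P bl.
have : (\int[P]_w `|(expR (- l * N (weighted_sum X q a w) `^ p))%:E| = 0)%E.
  under eq_integral => w _ do rewrite gee0_abs ?lee_fin ?expR_ge0//.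
  by rewrite -(fineK (integrable_fin_num measurableT il)) [fine _]e0.
have mE : measurable_fun setT
    (fun w => (expR (- l * N (weighted_sum X q a w) `^ p))%:E).
  by apply/measurable_EFinP; case: bl.
move/(ae_eq_integral_abs P measurableT mE) => [A [mA A0 sA]].
have : (P setT <= P A)%E.
  apply: le_measure; rewrite ?inE// => w _; apply: sA => /(_ I) /= [] /eqP.
  by rewrite expR_eq0.
by rewrite probability_setT A0 lee_fin ler10.
Qed.

(** A linear inequality between products of values of the Fourier transform, if
    it holds at every frequency, passes to the Laplace functional. *)
Lemma laplace_functional_lin_ge0 (J : finType) (c : J -> R)
    (a : J -> 'rV[R]_n) l :
  0 <= l ->
  (forall t, 0 <= \sum_j c j * \prod_i phi t (a j ord0 i)) ->
  0 <= \sum_j c j * laplace_functional X N p q l (a j).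
Proof.
move=> l0 c_ge0; pose W j := weighted_sum X q (a j).
have mW j : measurable_fun setT (W j) by exact: measurable_weighted_sum.
have pd1 : posdef P c W (fun=> 1).
  split; first exact: bounded_mfun_cst.
  move=> t; rewrite /lin_expect; under eq_bigr => j _.
    under eq_Rintegral => w _ do rewrite mul1r.
    rewrite (Rintegral_cos_weighted_sum q indX densX fourier_ge0).
    over.
  exact: c_ge0.
have [_ /(_ _ pd1) [_ /(_ 0)]] := laplace_multiplier c mW l0.
rewrite /lin_expect; under eq_bigr => j _.
  under eq_Rintegral => w _ do rewrite mul1r dotv0l cos0 mulr1.
  rewrite -laplace_functionalE.
  over.
exact.
Qed.

Lemma laplace_functional_le (l : R) (x y : 'rV[R]_n) : 0 <= l ->
  (forall t, \prod_i phi t (x ord0 i) <= \prod_i phi t (y ord0 i)) ->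
  laplace_functional X N p q l x <= laplace_functional X N p q l y.
Proof.
move=> l0 xy; rewrite -subr_ge0.
have := @laplace_functional_lin_ge0 bool (fun b => if b then 1 else -1)
  (fun b => if b then y else x) l l0.
rewrite big_bool/= mul1r mulN1r; apply=> t.
by rewrite big_bool/= mul1r mulN1r subr_ge0; exact: xy.
Qed.

Lemma moment_functional_le (x y : 'rV[R]_n) :
  (forall t, \prod_i phi t (x ord0 i) <= \prod_i phi t (y ord0 i)) ->
  (moment_functional X N p q y <= moment_functional X N p q x)%E.
Proof.
move=> xy; rewrite /moment_functional unlock.
have mN a : measurable_fun setT (fun w => N (weighted_sum X q a w) `^ p).
  have [me _] := bounded_mfun_laplace a (@ler01 R).
  (* Measurability of [N ^ p] is read off that of its exponential. *)
  rewrite (_ : (fun w => _) = fun w =>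
      - ln (expR (- 1 * N (weighted_sum X q a w) `^ p))); last first.
    by apply/funext => w; rewrite expRK mulN1r opprK.
  by apply: measurableT_comp => //; apply: measurableT_comp me => //;
     exact: measurable_ln.
apply: (le_mean_laplace (mN x) (mN y)) => [w|w|l l0].
- exact: powR_ge0.
- exact: powR_ge0.
have := laplace_functional_le (ltW l0) xy.
by rewrite (laplace_functionalE l x) (laplace_functionalE l y).
Qed.

Lemma laplace_functional_log_convex (l : R) : 0 < l ->
  (forall t : 'rV[R]_d, log_convex ([set s | 0 <= s] : set R^o)
     (fun s : R^o => phi t (s : R))) ->
  log_convex positive_orthant (laplace_functional X N p q l).
Proof.
move=> /ltW l0 lc; split=> [x _|x y k x0 y0 k01].
  exact: laplace_functional_ge0.
have x0' i : 0 <= x ord0 i by exact: ltW.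
have y0' i : 0 <= y ord0 i by exact: ltW.
apply: geometric_mean_tangent => //; try exact: laplace_functional_gt0.
move=> s s0; rewrite -subr_ge0.
pose c (j : 'I_3) := [:: k * s `^ (1 - k); (1 - k) * s `^ (- k); -1]`_j.
pose a (j : 'I_3) := nth 0 [:: x; y; k *: x + (1 - k) *: y] j.
have := @laplace_functional_lin_ge0 _ c a l l0.
rewrite !big_ord_recl !big_ord0 /c /a/= mulN1r addr0 addrA; apply=> t.
rewrite !big_ord_recl !big_ord0 /c /a/= mulN1r addr0 addrA subr_ge0.
apply: (le_trans (prod_log_convex (lc t) x0' y0' k01)).
apply: weighted_AMGM => //; apply: prodr_ge0 => i _; apply: (lc t).1.
- exact: x0'.
- exact: y0'.
Qed.

End laplace_functional_theory.

Theorem corollary4p5 (R : realType) (d n : nat) (p q : R)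
  (psi : 'rV[R]_d -> R) (N : 'rV[R]_d -> R)
  (disp : measure_display) (T : measurableType disp) (P : probability T R)
  (X : 'I_n.+1 -> {RV P >-> 'rV[R]_d}) :
  0 < q ->
  independent_RVs X ->
  (forall i, has_density (X i) psi) ->
  (forall x, psi (- x) = psi x) ->
  (forall x, 0 <= fourier psi x) ->
  complex_integrable (fourier psi) ->
  0 < p <= 2 ->
  quasi_norm N ->
  embeds_in_Lp p N ->
  ((forall t : 'rV[R]_d,
      log_convex ([set s | 0 <= s] : set R^o)
        (fun s : R^o => complex.Re (fourier psi ((s : R) `^ q^-1 *: t)))) ->
    (forall l : R, 0 < l ->
      log_convex positive_orthant (laplace_functional X N p q l)) /\
    (('E_P[fun w => (N (X ord0 w) `^ p)%R] < +oo)%E ->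
      schur_concave nonneg_orthant (moment_functional X N p q)))
  /\
  ((forall t : 'rV[R]_d,
      log_concave ([set s | 0 <= s] : set R^o)
        (fun s : R^o => complex.Re (fourier psi ((s : R) `^ q^-1 *: t)))) ->
    (forall l : R, 0 < l ->
      schur_concave positive_orthant (laplace_functional X N p q l)) /\
    (('E_P[fun w => (N (X ord0 w) `^ p)%R] < +oo)%E ->
      schur_convex nonneg_orthant (moment_functional X N p q))).
Proof.
move=> _ indX densX _ fourier_ge0 _ p02 _ embN; split=> logc.
- split=> [l l0|_].
    exact: (laplace_functional_log_convex indX densX fourier_ge0 p02 embN).
  move=> x y _ y0 xy.
  apply: (moment_functional_le indX densX fourier_ge0 p02 embN) => t.
  have := @prod_majorized R (fun u v => u <= v)
    (fun s => complex.Re (fourier psi (s `^ q^-1 *: t))).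
  apply.
  + by move=> u; exact: lexx.
  + by move=> v u w; exact: le_trans.
  + by move=> c u v c0; exact: ler_wpM2l.
  + exact: (logc t).1.
  + exact: log_convex_transfer (logc t).
  + exact: y0.
  + exact: xy.
- have prod_ge (x y : 'rV[R]_n.+1) :
      (forall i, 0 <= y ord0 i) -> majorized x y -> forall t,
      \prod_i complex.Re (fourier psi (y ord0 i `^ q^-1 *: t)) <=
      \prod_i complex.Re (fourier psi (x ord0 i `^ q^-1 *: t)).
    move=> y0 xy t.
    have := @prod_majorized R (fun u v => v <= u)
      (fun s => complex.Re (fourier psi (s `^ q^-1 *: t))).
    apply.
    + by move=> u; exact: lexx.
    + by move=> v u w /[swap]; exact: le_trans.
    + by move=> c u v c0; exact: ler_wpM2l.
    + exact: (logc t).1.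
    + exact: log_concave_transfer (logc t).
    + exact: y0.
    + exact: xy.
  split=> [l l0|_] x y _ y0 xy.
    apply: (laplace_functional_le indX densX fourier_ge0 p02 embN (ltW l0)).
    by apply: prod_ge => // i; exact: ltW.
  apply: (moment_functional_le indX densX fourier_ge0 p02 embN).
  exact: prod_ge.
Qed.
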